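(* Every threshold dot-depth one language belongs to $\mathcal{P}(\mathbf{J})$.
   Context: $\mathbb{N}$ includes $0$; $[n] = \{1, \ldots, n\}$; all alphabets are finite. Threshold dot-depth one languages. A word $u$ is a subword of $w$ if it is a (not necessarily contiguous) subsequence of $w$; it is a factor of $w$ if $w = xuy$ for some words $x, y$. Let $\Sigma$ be an alphabet. For $u \in \Sigma^*$, let $\mathrm{Sub}(u) \subseteq \Sigma^*$ be the language of all words over $\Sigma$ having $u$ as a subword. For $u \in \Sigma^+$ and $l \in \mathbb{N}_{>0}$, let $[u]_l = \Sigma^* u \Sigma^* \cup \mathrm{Sub}(u^l)$. For $k \geq 2$ and $u_1, \ldots, u_k \in \Sigma^+$, let $[u_1, \ldots, u_k]_l = [u_1]_l [u_2]_l \cdots [u_k]_l$ (concatenation of languages). A threshold dot-depth one language over $\Sigma$ is any Boolean combination of languages over $\Sigma$ of the form $\Sigma^* u$, $u \Sigma^*$ and $[u_1, \ldots, u_k]_l$, for $k, l \in \mathbb{N}_{>0}$ and $u, u_1, \ldots, u_k \in \Sigma^+$. The class $\mathcal{P}(\mathbf{J})$. The idempotent power of a finite monoid $M$ is the smallest $\omega \in \mathbb{N}_{>0}$ with $x^\omega = x^{2\omega}$ for all $x \in M$. $\mathbf{J}$ is the class of finite monoids $M$, of idempotent power $\omega$, such that $(xy)^\omega = (xy)^\omega x = y (xy)^\omega$ for all $x, y \in M$. A program $P$ over a finite monoid $M$ on $\Sigma^n$ is a finite sequence of instructions $(i, f)$ with $i \in [n]$ and $f \colon \Sigma \to M$; its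 length $|P|$ is its number of instructions. On input $w \in \Sigma^n$, instruction $(i, f)$ outputs $f(w_i)$, and $P(w) \in M$ is the product, in order, of these outputs. $P$ recognises $L \subseteq \Sigma^n$ if $L = P^{-1}(F)$ for some $F \subseteq M$. $\mathcal{P}(\mathbf{J})$ is the class of languages $L \subseteq \Sigma^*$ ($\Sigma$ any alphabet) for which there exist a monoid $M \in \mathbf{J}$, a real $\alpha > 0$, an integer $j \in \mathbb{N}$ and programs $P_n$ over $M$ on $\Sigma^n$ ($n \in \mathbb{N}$) such that $P_n$ recognises $L \cap \Sigma^n$ and $|P_n| \leq \alpha \cdot n^j$ for all $n \in \mathbb{N}$. *)

(* Defs.v *)
From HB Require Import structures.
From mathcomp Require Import all_boot all_order all_algebra.
From mathcomp Require Import boolp classical_sets reals.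
Set Implicit Arguments.
Unset Strict Implicit.
Unset Printing Implicit Defensive.
Import Order.TTheory GRing.Theory Num.Theory.

Local Open Scope classical_set_scope.

#[short(type="finMonoidType")]
HB.structure Definition FinMonoid := { M of Monoid M & Finite M }.

Section Languages.
Variable Sigma : finType.
Implicit Types (u : seq Sigma) (us : seq (seq Sigma)) (l : nat).

Definition language := set (seq Sigma).
Implicit Types K L : language.

Definition cat_lang K L : language :=
  [set w | exists x y, [/\ K x, L y & w = x ++ y]].

Definition word_pow u l : seq Sigma := flatten (nseq l u).

Definition subword_lang u : language := [set w | subseq u w].

(* [u]_l *)
Definition threshold_factor l u : language :=
  cat_lang (cat_lang setT [set u]) setT `|` subword_lang (word_pow u l).

(* [u_1, ..., u_k]_l; the trailing {[::]} of the fold is the unit of cat_lang,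
   so this is [u_1]_l when k = 1. *)
Definition threshold_factors l us : language :=
  foldr cat_lang [set [::]] (map (threshold_factor l) us).

Inductive tdd1_basic : language -> Prop :=
| Tdd1Suffix u : u != [::] -> tdd1_basic (cat_lang setT [set u])
| Tdd1Prefix u : u != [::] -> tdd1_basic (cat_lang [set u] setT)
| Tdd1Factors l us : 0 < l -> 0 < size us -> all (fun u => u != [::]) us ->
    tdd1_basic (threshold_factors l us).

End Languages.

Inductive boolean_combination (T : Type) (G : set T -> Prop) : set T -> Prop :=
| BoolBase A : G A -> boolean_combination G A
| BoolEmpty : boolean_combination G set0
| BoolCompl A : boolean_combination G A -> boolean_combination G (~` A)
| BoolUnion A B : boolean_combination G A -> boolean_combination G B ->
    boolean_combination G (A `|` B)
| BoolInter A B : boolean_combination G A -> boolean_combination G B ->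
    boolean_combination G (A `&` B).

Definition threshold_dot_depth_one (Sigma : finType) (L : language Sigma) :=
  boolean_combination (@tdd1_basic Sigma) L.

Section Monoids.
Local Open Scope group_scope.
Variable M : finMonoidType.

Definition is_idempotent_exponent (omega : nat) : Prop :=
  (0 < omega)%N /\ forall x : M, x ^+ omega = x ^+ (2 * omega)%N.

Definition is_idempotent_power (omega : nat) : Prop :=
  is_idempotent_exponent omega /\
  forall m : nat, is_idempotent_exponent m -> (omega <= m)%N.

(* Every finite monoid has exactly one idempotent power. *)
Definition in_J : Prop :=
  exists2 omega : nat, is_idempotent_power omega &
    forall x y : M, (x * y) ^+ omega = (x * y) ^+ omega * x /\
                    (x * y) ^+ omega * x = y * (x * y) ^+ omega.

End Monoids.

Section Programs.
Variables (Sigma : finType) (M : finMonoidType) (n : nat).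

Definition program := seq ('I_n * (Sigma -> M)).

Definition run (P : program) (w : n.-tuple Sigma) : M :=
  (\prod_(a <- P) a.2 (tnth w a.1))%g.

Definition recognises (P : program) (L : set (n.-tuple Sigma)) : Prop :=
  exists F : set M, L = run P @^-1` F.

End Programs.

(* R is the real field in which the constant alpha is taken. *)
Definition in_PJ (R : realType) (Sigma : finType) (L : language Sigma) : Prop :=
  exists (M : finMonoidType) (alpha : R) (j : nat)
         (P : forall n, program Sigma M n),
    [/\ in_J M, (0 < alpha)%R &
        forall n, recognises (P n) [set w : n.-tuple Sigma | L w] /\
                  ((size (P n))%:R <= alpha * n%:R ^+ j)%R].

(* Main.v *)
(* Since morphisms into a monoid of J detect exactly the subwords of bounded
   length, a program over such a monoid can compute which short words are
   subwords of a word of polynomial length obtained by reading the letters of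
   the input, possibly several times and out of order.

   The language [u_1, ..., u_k]_l is recognised as follows.  Colouring every
   letter with its position modulo a large integer reduces the problem to words
   u_i with pairwise distinct letters.  Read position i at every time i + d, for
   the delays d up to a bound, simultaneous readings being ordered by d.  The
   letters of v = u_i, read backwards with consecutive delays, then occur as a
   subword exactly at positions q_1, ..., q_m with q_(s+1) <= q_s + 1.  As the
   letters of v are distinct, either these positions form a factor v or
   q_m < q_1.  Frame this test by v^a v_1 ... v_(m-1) before and by
   v_2 ... v_m v^b after: in the second case the subword v^(a+b+2) appears.
   This is excluded by guessing the exponents j_i = a + b + 1 and requiring that
   no j_i < l can be increased: the word v_1^(j_1) ... v_i^(j_i + 1) ... v_k^(j_k)
   is not a subword.

   Every word of the language passes such a test: a factorization maximizing
   the sum of the exponents works, because comparing its cuts one by one with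
   those of an embedding of larger powers would produce a heavier
   factorization. *)
Require Import Defs.
From HB Require Import structures.
From mathcomp Require Import all_boot all_algebra reals.
From mathcomp Require Import boolp classical_sets zify.
Set Implicit Arguments.
Unset Strict Implicit.
Unset Printing Implicit Defensive.
Import GRing.Theory Num.Theory.

(** * The monoid of subword matching *)

Section MatchingMonoid.
Variables (N : nat) (A : finType).
Implicit Types (v : N.-bseq A) (s : seq A).

(** A state is the part of a candidate word still to be matched. Maps that are decreasing and
    monotone for the subword order are closed under composition and form a $\mathcal{J}$-trivial
    monoid; the bound [N] keeps it finite. *)
Definition matching_fun (f : {ffun N.-bseq A -> N.-bseq A}) :=
  [forall v, subseq (f v) v] &&
  [forall v : N.-bseq A, forall v' : N.-bseq A,
     subseq v' v ==> subseq (f v') (f v)].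

Definition matching := {f | matching_fun f}.

Definition Matching f (fP : matching_fun f) : matching :=
  exist (fun f => is_true (matching_fun f)) f fP.

HB.instance Definition _ := Finite.on matching.

Lemma matching_le (f : matching) v : subseq (val f v) v.
Proof. by case: f => f /= /andP[/forallP + _]; apply. Qed.

Lemma matching_mono (f : matching) v v' :
  subseq v' v -> subseq (val f v') (val f v).
Proof.
by case: f => f /= /andP[_ /forallP/(_ v)/forallP/(_ v')/implyP]; apply.
Qed.

Lemma matching_id_subproof : matching_fun [ffun v => v].
Proof.
apply/andP; split; apply/forallP => v; first by rewrite ffunE.
by apply/forallP => v'; rewrite !ffunE; apply/implyP.
Qed.

Lemma matching_comp_subproof (f g : matching) :
  matching_fun [ffun v => val g (val f v)].
Proof.
apply/andP; split; apply/forallP => v.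
  by rewrite ffunE; apply: subseq_trans (matching_le _ _) (matching_le _ _).
apply/forallP => v'; rewrite !ffunE; apply/implyP => vv'.
by do 2!apply: matching_mono.
Qed.

Definition matching_one : matching := Matching matching_id_subproof.
(** [f] acts before [g], so that a product consumes letters in reading order. *)
Definition matching_mul f g : matching := Matching (matching_comp_subproof f g).

Lemma matching_ext (f g : matching) : val f =1 val g -> f = g.
Proof. by move=> fg; apply/val_inj/ffunP. Qed.

Lemma matching_mulA : associative matching_mul.
Proof. by move=> f g h; apply: matching_ext => v; rewrite !ffunE. Qed.

Lemma matching_mul1 : left_id matching_one matching_mul.
Proof. by move=> f; apply: matching_ext => v; rewrite !ffunE. Qed.

Lemma matching_mulr1 : right_id matching_one matching_mul.
Proof. by move=> f; apply: matching_ext => v; rewrite !ffunE. Qed.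

HB.instance Definition _ :=
  isMonoid.Build matching matching_mulA matching_mul1 matching_mulr1.

Definition matching_monoid : finMonoidType := matching.

Lemma behead_subproof v : size (behead v) <= N.
Proof. by rewrite size_behead (leq_trans (leq_pred _)) ?size_bseq. Qed.

Definition match_letter (a : A) v : N.-bseq A :=
  if ohead v == Some a then Bseq (behead_subproof v) else v.

(** Greedy matching loses nothing: if the first letter of [v] is available, it may as well be used
    at once. *)
Lemma match_letterP a v s : subseq v (a :: s) = subseq (match_letter a v) s.
Proof.
rewrite /match_letter; case: v => [[|b v] /= vN]; first by rewrite sub0seq.
by rewrite (inj_eq Some_inj); case: (b == a).
Qed.

Lemma match_letter_fun_subproof a : matching_fun [ffun v => match_letter a v].
Proof.
apply/andP; split; apply/forallP => v.
  rewrite ffunE /match_letter; case: ifP => // _ /=.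
  by rewrite -drop1 drop_subseq.
apply/forallP => v'; rewrite !ffunE; apply/implyP => v'v.
(* By [match_letterP], it suffices that [v'] is a subword of [a] followed by the remainder of [v];
   [v] itself is one. *)
rewrite -match_letterP; apply: (subseq_trans v'v).
by rewrite match_letterP.
Qed.

Definition letter_matching a : matching :=
  Matching (match_letter_fun_subproof a).

(** This makes the product determine which words of length at most [N] are subwords of [s]. *)
Lemma prod_letter_matchingP s v :
  subseq v s = (val (\prod_(a <- s) letter_matching a)%g v == [bseq]).
Proof.
elim: s v => [|a s IHs] v.
  by rewrite subseq0 big_nil /= ffunE -val_eqE.
by rewrite big_cons match_letterP IHs /= !ffunE.
Qed.

(* The pointwise order by matching progress makes 1 the least element, so
   that x^n is increasing in n. *)
Definition matching_below (f g : matching) :=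
  forall v, subseq (val g v) (val f v).

Lemma matching_below_anti f g :
  matching_below f g -> matching_below g f -> f = g.
Proof.
move=> fg gf; apply: matching_ext => v; apply/val_inj/subseq_anti.
by rewrite gf fg.
Qed.

Lemma matching_below_mulr (f g : matching_monoid) : matching_below f (f * g)%g.
Proof. by move=> v; rewrite /= ffunE matching_le. Qed.

Lemma matching_below_mull (f g : matching_monoid) : matching_below f (g * f)%g.
Proof. by move=> v; rewrite /= ffunE; apply/matching_mono/matching_le. Qed.

Lemma matching_below_expg (f : matching_monoid) m n :
  m <= n -> matching_below (f ^+ m)%g (f ^+ n)%g.
Proof. by move=> /subnKC <-; rewrite expgnDr; apply: matching_below_mulr. Qed.

Lemma matching_expg_stable (f : matching_monoid) omega :
  0 < omega -> (f ^+ omega = f ^+ (2 * omega))%g ->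
  forall n, omega <= n -> n <= 2 * omega -> (f ^+ omega = f ^+ n)%g.
Proof.
move=> o0 fo n on no; apply: matching_below_anti.
  exact: matching_below_expg.
by rewrite fo; apply: matching_below_expg.
Qed.

(** By pigeonhole $f^i = f^j$ for some $i < j \le K$. As powers increase, those in between are equal
    too, so the powers are constant from [i] on. *)
Lemma matching_exists_idempotent_exponent :
  exists n, is_idempotent_exponent matching_monoid n.
Proof.
set K := #|{: matching_monoid}|.
have K0 : 0 < K by apply/card_gt0P; exists 1%g.
exists K; split=> // f.
have [i [j [ij jK fij]]] : exists i j, [/\ i < j, j <= K & (f ^+ i = f ^+ j)%g].
  pose h (i : 'I_K.+1) := (f ^+ i)%g.
  have /injectivePn[i [j ij hij]] : ~~ injectiveb h.
    apply/negP => /injectiveP/leq_card; rewrite card_ord /= -/K ltnn //.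
  have := ltn_ord i; have := ltn_ord j; rewrite !ltnS => jK iK.
  case: (ltngtP i j) ij hij => [ij _ h_|ij _ h_|/val_inj -> /eqP//].
    by exists i, j.
  by exists j, i.
have stable n : i <= n -> (f ^+ n = f ^+ i)%g.
  move=> /subnKC <-; elim: (n - i) => [|k IHk]; first by rewrite addn0.
  rewrite addnS expgSr IHk -expgSr; apply: matching_below_anti.
    by rewrite [X in matching_below _ X]fij; apply: matching_below_expg.
  by apply: matching_below_expg.
by rewrite !stable //; lia.
Qed.

(** With $e = (xy)^n$, the product $ex$ lies between $e$ and $e(xy)$, and $ye$ between $e$ and
    $(xy)e$; both upper bounds equal $e$. *)
Lemma matching_in_J : in_J matching_monoid.
Proof.
have [n0 n0P] := matching_exists_idempotent_exponent.
have exP : exists n, `[< is_idempotent_exponent matching_monoid n >].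
  by exists n0; apply/asboolP.
exists (ex_minn exP).
  case: ex_minnP => n /asboolP nP nmin; split=> // m mP.
  by apply: nmin; apply/asboolP.
case: ex_minnP => n /asboolP[n0' nP] _ x y.
have st := matching_expg_stable n0' (nP (x * y)%g).
have stS : ((x * y) ^+ n = (x * y) ^+ n.+1)%g by apply: st; lia.
have -> : ((x * y) ^+ n * x = (x * y) ^+ n)%g.
  apply: matching_below_anti; last exact: matching_below_mulr.
  rewrite [X in matching_below _ X]stS expgSr mulgA; exact: matching_below_mulr.
split=> //; apply: matching_below_anti; first exact: matching_below_mull.
rewrite [X in matching_below _ X]stS expgS -mulgA; exact: matching_below_mull.
Qed.

End MatchingMonoid.

(** * Languages determined by subwords of a program output *)

Section SubwordPrograms.
Variable Sigma : finType.
Implicit Types L : language Sigma.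

Definition program_output (T : finType) n (P : seq ('I_n * T))
    (w : n.-tuple Sigma) : seq (T * Sigma) :=
  [seq (p.2, tnth w p.1) | p <- P].

(** The program is independent of any monoid: instructions only carry a tag from [T]. One
    implication is enough in the second condition, its hypothesis being symmetric in [w] and
    [w']. *)
Definition subword_determined L :=
  exists (T : finType) (N c : nat) (P : forall n, seq ('I_n * T)),
    (forall n, size (P n) <= c * n) /\
    forall n (w w' : n.-tuple Sigma),
      (forall v, size v <= N ->
         subseq v (program_output (P n) w) =
         subseq v (program_output (P n) w')) ->
      L w -> L w'.

Lemma subword_determined_in_PJ (R : realType) L :
  subword_determined L -> in_PJ R L.
Proof.
move=> [T [N [c [P [Psize Pdet]]]]].
pose instr n (p : 'I_n * T) :
    'I_n * (Sigma -> matching_monoid N (T * Sigma)%type) :=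
  (p.1, fun a => letter_matching N (p.2, a)).
(* The constant is [c.+1] rather than [c] because it must be positive. *)
exists (matching_monoid N (T * Sigma)%type), (c.+1)%:R%R, 1,
  (fun n => map (@instr n) (P n)).
have runE n w : run (map (@instr n) (P n)) w =
    (\prod_(a <- program_output (P n) w) letter_matching N a)%g.
  by rewrite /run /program_output !big_map.
split; first exact: matching_in_J.
  by rewrite ltr0n.
move=> n; split; last first.
  rewrite size_map expr1 -natrM ler_nat (leq_trans (Psize n)) //.
  by rewrite leq_mul2r leqnSn orbT.
(* The accepting set is the image of the language. Words with equal products have the same short
   subwords, so no other word is mapped into it. *)
exists (run (map (@instr n) (P n)) @` [set w : n.-tuple Sigma | L w])%classic.
apply/seteqP; split=> w /=; first by move=> Lw; exists w.
move=> [w' Lw' ww']; apply: Pdet Lw' => v vN.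
have -> : v = Bseq vN by [].
by rewrite !(prod_letter_matchingP _ (Bseq vN)) -!runE ww'.
Qed.

Lemma subword_determined_set0 : subword_determined (@set0 (seq Sigma)).
Proof. by exists unit, 0, 0, (fun _ => [::]). Qed.

Lemma subword_determinedC L :
  subword_determined L -> subword_determined (~` L)%classic.
Proof.
move=> [T [N [c [P [Psize Pdet]]]]]; exists T, N, c, P; split=> // n w w' ww'.
by move=> nLw /(@Pdet n w' w) Lw; apply/nLw/Lw => v vN; rewrite ww'.
Qed.

Lemma subseq_map_filter (A B : eqType) (f : A -> B) (a : pred B) v s s' :
  injective f -> (forall x, a (f x)) -> filter a s' = map f s ->
  subseq (map f v) s' = subseq v s.
Proof.
move=> injf af fs; apply/idP/idP => [vs'|/(map_subseq f) vs].
  have : subseq (map f v) (map f s).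
    by rewrite -fs subseq_filter vs' andbT all_map; apply/allP => x _ /=.
  case/subseqP => m mv; rewrite -map_mask => /(inj_map injf) ->.
  exact: mask_subseq.
by apply: (subseq_trans vs); rewrite -fs filter_subseq.
Qed.

Lemma subseq_map_inl (T1 T2 : eqType) (T := (T1 + T2)%type)
    (v s1 : seq (T1 * Sigma)) (s2 : seq (T2 * Sigma)) :
  subseq [seq (inl p.1 : T, p.2) | p <- v]
    ([seq (inl p.1 : T, p.2) | p <- s1] ++ [seq (inr p.1 : T, p.2) | p <- s2]) =
  subseq v s1.
Proof.
pose isl (p : T * Sigma) := if p.1 is inl _ then true else false.
apply: (@subseq_map_filter _ _ _ isl) => //.
  by move=> [? ?] [? ?] /= [-> ->].
rewrite filter_cat (_ : filter _ (map _ s2) = [::]) ?cats0; first last.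
  by elim: s2 => //= *.
by elim: s1 => //= ? ? ->.
Qed.

Lemma subseq_map_inr (T1 T2 : eqType) (T := (T1 + T2)%type)
    (v s2 : seq (T2 * Sigma)) (s1 : seq (T1 * Sigma)) :
  subseq [seq (inr p.1 : T, p.2) | p <- v]
    ([seq (inl p.1 : T, p.2) | p <- s1] ++ [seq (inr p.1 : T, p.2) | p <- s2]) =
  subseq v s2.
Proof.
pose isr (p : T * Sigma) := if p.1 is inr _ then true else false.
apply: (@subseq_map_filter _ _ _ isr) => //.
  by move=> [? ?] [? ?] /= [-> ->].
rewrite filter_cat (_ : filter _ (map _ s1) = [::]); first last.
  by elim: s1 => //= *.
by elim: s2 => //= ? ? ->.
Qed.

(** The two programs run one after the other. Tags from the disjoint sum keep their letters apart,
    so the subwords of each output can be recovered. *)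
Lemma subword_determined_combine L1 L2 L :
  (forall w w', (L1 w -> L1 w') -> (L2 w -> L2 w') -> L w -> L w') ->
  subword_determined L1 -> subword_determined L2 -> subword_determined L.
Proof.
move=> LL [T1 [N1 [c1 [P1 [P1size P1det]]]]] [T2 [N2 [c2 [P2 [P2size P2det]]]]].
exists (T1 + T2)%type, (maxn N1 N2), (c1 + c2), (fun n =>
  [seq (p.1, inl p.2) | p <- P1 n] ++ [seq (p.1, inr p.2) | p <- P2 n]).
have outE n w : program_output ([seq (p.1, inl p.2) | p <- P1 n] ++
    [seq (p.1, inr p.2) | p <- P2 n]) w =
    [seq (inl p.1, p.2) | p <- program_output (P1 n) w] ++
    [seq (inr p.1, p.2) | p <- program_output (P2 n) w].
  by rewrite /program_output map_cat -!map_comp.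
split=> [n|n w w' ww'].
  by rewrite size_cat !size_map mulnDl leq_add.
apply: LL; [apply: P1det => v vN | apply: P2det => v vN].
  rewrite -(subseq_map_inl _ _ (program_output (P2 n) w)) -outE ww'.
    by rewrite outE subseq_map_inl.
  by rewrite size_map leq_max vN.
rewrite -(subseq_map_inr _ _ (program_output (P1 n) w)) -outE ww'.
  by rewrite outE subseq_map_inr.
by rewrite size_map leq_max vN orbT.
Qed.

Lemma boolean_combination_subword_determined G L :
  (forall K, G K -> subword_determined K) ->
  boolean_combination G L -> subword_determined L.
Proof.
move=> GP; elim=> [A /GP //||A _ HA|A B _ HA _ HB|A B _ HA _ HB].
- exact: subword_determined_set0.
- exact: subword_determinedC.
- apply: subword_determined_combine HA HB => w w' /= H1 H2.
  by case=> [/H1|/H2]; [left|right].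
- by apply: subword_determined_combine HA HB => w w' /= H1 H2 [/H1 ? /H2].
Qed.

(** Each relevant position is read with its index [t] as tag, and one-letter subwords reveal the
    letter. Positions beyond the end are not read; [onth] gives [None] there. *)
Lemma position_determined (m : nat) (pos : nat -> nat -> nat) L :
  (forall w w', size w = size w' ->
     (forall t, t < m -> onth w (pos (size w) t) = onth w' (pos (size w) t)) ->
     L w -> L w') ->
  subword_determined L.
Proof.
move=> posL.
pose P n : seq ('I_n * 'I_m) :=
  [seq p : 'I_n * 'I_m <- enum predT | p.1 == pos n p.2 :> nat].
have letterP n (w : n.-tuple Sigma) (t : 'I_m) a :
    subseq [:: (t, a)] (program_output (P n) w) = (onth w (pos n t) == Some a).
  rewrite sub1seq; apply/mapP/eqP => [[[i t'] /=]|ta].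
    rewrite mem_filter /= => /andP[/eqP ip _] [-> ->]; rewrite -ip.
    by rewrite onthE (nth_map a) ?size_tuple // -tnth_nth.
  have tn : pos n t < n.
    by rewrite -[X in _ < X](size_tuple w) -onthTE ta.
  exists (Ordinal tn, t); first by rewrite mem_filter /= eqxx mem_enum.
  by rewrite /= (tnth_nth a) /= (@onth_nth _ a _ _ _ ta).
exists 'I_m, 1, m, P; split=> [n|n w w' ww'].
  rewrite size_filter (leq_trans (count_size _ _)) // -cardE card_prod.
  by rewrite !card_ord mulnC.
apply: posL; rewrite !size_tuple // => t tm.
case wt: (onth w _) => [a|]; last first.
  suff: ~~ onth w' (pos n t) by case: onth.
  by rewrite onthTE size_tuple -[X in _ < X](size_tuple w) -onthTE wt.
by apply/esym/eqP; rewrite -(@letterP _ w' (Ordinal tm)) -ww' // letterP /= wt.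
Qed.

Lemma prefix_subword_determined (u : seq Sigma) :
  subword_determined (cat_lang [set u] setT)%classic.
Proof.
apply: (@position_determined (size u) (fun _ t => t)) => w w' ww' eqw.
move=> [_ [y [-> _ defw]]]; exists u, (drop (size u) w'); split=> //.
rewrite -[LHS](cat_take_drop (size u)); congr (_ ++ _).
apply: eq_from_onth => i; have [iu|ui] := ltnP i (size u); last first.
  by rewrite !onth_default // size_take; case: ifP => // /negbT; lia.
move: (eqw i iu); rewrite !onthE !map_take nth_take // => <-.
by rewrite defw map_cat nth_cat size_map iu.
Qed.

Lemma suffix_subword_determined (u : seq Sigma) :
  subword_determined (cat_lang setT [set u])%classic.
Proof.
(* The truncated subtraction is harmless: [w] ends with [u], hence is at least as long. *)
apply: (@position_determined (size u) (fun n t => n - size u + t)).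
move=> w w' ww' eqw.
move=> [x [_ [_ -> defw]]].
exists (take (size w - size u) w'), u; split=> //.
rewrite -[LHS](cat_take_drop (size w - size u)); congr (_ ++ _).
apply: eq_from_onth => i; have [iu|ui] := ltnP i (size u); last first.
  by rewrite !onth_default // size_drop -ww' defw size_cat; lia.
move: (eqw i iu); rewrite !onthE !map_drop nth_drop => <-.
rewrite defw size_cat map_cat addnK nth_cat size_map ltnNge leq_addr /=.
by rewrite addKn.
Qed.

End SubwordPrograms.

(** * Slices and powers of words *)

Lemma subseq_cat_split (T : eqType) (s x y : seq T) :
  subseq s (x ++ y) ->
  exists s1 s2, [/\ s = s1 ++ s2, subseq s1 x & subseq s2 y].
Proof.
case/subseqP => m; rewrite size_cat => sm ->.
exists (mask (take (size x) m) x), (mask (drop (size x) m) y).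
split; rewrite ?mask_subseq // -mask_cat ?cat_take_drop // size_take sm.
by case: ltnP => //; lia.
Qed.

Lemma cat_subseq_split (T : eqType) (s1 s2 t : seq T) :
  subseq (s1 ++ s2) t ->
  exists2 k, subseq s1 (take k t) & subseq s2 (drop k t).
Proof.
elim: t s1 => [|b t IHt] [|a s1] //=; try by exists 0; rewrite ?drop0 ?take0.
have [->|ab] := eqVneq a b => [/IHt|/(IHt (a :: s1))] [k s1k s2k];
  exists k.+1 => //=.
  by rewrite eqxx.
by rewrite (negPf ab).
Qed.

Section Slices.
Variables (T : finType) (z : seq T).
Implicit Types (v : seq T) (a b c d f j l : nat).

Lemma word_powS v j : word_pow v j.+1 = v ++ word_pow v j.
Proof. by []. Qed.

Lemma word_powD v j k : word_pow v (j + k) = word_pow v j ++ word_pow v k.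
Proof. by rewrite /word_pow nseqD flatten_cat. Qed.

Lemma word_powSr v j : word_pow v j.+1 = word_pow v j ++ v.
Proof. by rewrite -addn1 word_powD /word_pow /= cats0. Qed.

Lemma subseq_word_pow v j k : j <= k -> subseq (word_pow v j) (word_pow v k).
Proof. by move=> /subnKC <-; rewrite word_powD prefix_subseq. Qed.

Lemma size_word_pow v j : size (word_pow v j) = j * size v.
Proof. by elim: j => //= j IHj; rewrite word_powS size_cat IHj. Qed.

(** A nonempty suffix of the power matched inside [s] would end with [x]. *)
Lemma word_pow_last v0 x j p s : x \notin s ->
  subseq (word_pow (rcons v0 x) j) (p ++ s) ->
  subseq (word_pow (rcons v0 x) j) p.
Proof.
case: j => [|j] xs; first by rewrite !sub0seq.
move=> /subseq_cat_split[s1 [s2 [+ s1p s2s]]].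
case: (lastP s2) s2s => [|s2' y] s2s; first by rewrite cats0 => ->.
rewrite word_powSr -!rcons_cat => /rcons_inj[_ xy].
have := mem_subseq s2s; move/(_ y).
by rewrite mem_rcons mem_head -xy (negPf xs) => /(_ isT).
Qed.

Lemma word_pow_head v0 x j p s : x \notin p ->
  subseq (word_pow (x :: v0) j) (p ++ s) ->
  subseq (word_pow (x :: v0) j) s.
Proof.
case: j => [|j] xp; first by rewrite !sub0seq.
move=> /subseq_cat_split[[|y s1] [s2 [+ s1p s2s]]]; first by move=> ->.
rewrite word_powS /= => -[xy _].
by move: (mem_subseq s1p (mem_head y s1)); rewrite -xy (negPf xp).
Qed.

Definition slice a b := take (b - a) (drop a z).

Lemma slice_cat a b c : a <= b -> b <= c -> slice a c = slice a b ++ slice b c.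
Proof.
move=> ab bc; rewrite /slice (_ : c - a = (b - a) + (c - b)); last by lia.
by rewrite takeD drop_drop subnK.
Qed.

Lemma take_slice a k m : k <= m ->
  slice a (a + k) = take k (slice a (a + m)).
Proof. by move=> km; rewrite /slice !addKn take_takel. Qed.

Lemma behead_slice a m : behead (slice a (a + m.+1)) = slice a.+1 (a + m.+1).
Proof.
by rewrite /slice addKn addnS subSS addKn -addn1 -drop1 -take_drop drop_drop add1n.
Qed.

Lemma slice_infix a b c d : c <= a -> b <= d -> infix (slice a b) (slice c d).
Proof.
move=> ca bd; have [ab|ba] := leqP a b; last first.
  by rewrite {1}/slice (_ : b - a = 0) ?take0 ?infix0s //; lia.
rewrite (@slice_cat c a d) ?(@slice_cat a b d) //; last by lia.
exact: infix_infix.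
Qed.

Lemma slice_subseq a b c d : c <= a -> b <= d -> subseq (slice a b) (slice c d).
Proof. by move=> ca bd; apply/infixW/slice_infix. Qed.

Lemma size_slice a b : size (slice a b) <= b - a.
Proof. by rewrite /slice size_take_min geq_minl. Qed.

Lemma infix_sliceP v a b : v != [::] -> infix v (slice a b) ->
  exists f, [/\ a <= f, f + size v <= b & slice f (f + size v) = v].
Proof.
move=> v0 /infixP[p [q defs]]; exists (a + size p); split; first exact: leq_addr.
  have := size_slice a b; rewrite defs !size_cat.
  by case: v v0 {defs} => //= x v _; lia.
rewrite {1}/slice addKn.
have -> : drop (a + size p) z = drop (size p) (drop a z) by rewrite drop_drop addnC.
rewrite -[drop a z](cat_take_drop (b - a)) -/(slice a b) defs -!catA.
by rewrite drop_size_cat // take_size_cat.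
Qed.

Lemma drop_slice c d : c <= d -> drop c z = slice c d ++ drop d z.
Proof.
by move=> cd; rewrite -{1}(cat_take_drop (d - c) (drop c z)) drop_drop subnK.
Qed.

End Slices.

(** * The exchange argument *)

Section Exchange.
Variables (T : finType) (z : seq T) (l : nat).
Implicit Types (v : seq T) (vs : seq (seq T)) (js : seq nat) (c d s : nat).

Local Notation slice := (slice z).

Definition factor_word v := (v != [::]) && uniq v.

(* [heavy v x s]: x belongs to [v]_l, with s a lower bound, capped at l, on the
   largest power of v that is a subword of x. *)
Definition heavy v x s :=
  (s = l /\ subseq (word_pow v l) x) \/
  [/\ s < l, infix v x & subseq (word_pow v s) x].

Lemma heavy_infix v x y s : infix x y -> heavy v x s -> heavy v y s.
Proof.
move=> xy [[sl vx]|[sl vx vsx]]; [left|right]; split=> //.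
- exact: subseq_trans vx (infixW xy).
- exact: infix_trans vx xy.
- exact: subseq_trans vsx (infixW xy).
Qed.

Lemma heavy_pow v x s t : s <= t -> t <= l ->
  heavy v x s -> subseq (word_pow v t) x -> heavy v x t.
Proof.
move=> st tl hx vtx; move: tl; rewrite leq_eqVlt => /predU1P[tl|tl].
  by left; rewrite -{2}tl.
case: hx => [[sl _]|[_ vx _]]; first by lia.
by right.
Qed.

(** Before [d], the occurrence of [v] at [f] shows at most its first [size v - 1] letters. These
    miss the last letter of [v], the letters being distinct, so no part of the power needs to be
    matched there. *)
Lemma subseq_before_factor v c d e f : factor_word v -> c <= f -> d < f + size v ->
  slice f (f + size v) = v -> subseq (word_pow v e) (slice c d) ->
  subseq (word_pow v e) (slice c f).
Proof.
case/andP=> v0 vu cf dv fv vsub; apply: (@subseq_trans _ (slice c f)) => //.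
case: (lastP v) v0 vu dv fv vsub => // v' x _ + + fv.
rewrite rcons_uniq size_rcons addnS ltnS => /andP[xv' _] dv vsub.
have cd := slice_subseq z (leqnn c) dv.
apply: (word_pow_last xv'); apply: subseq_trans vsub _.
apply: (subseq_trans cd); rewrite (@slice_cat _ z c f) ?leq_addr //.
rewrite (_ : slice f _ = v') //.
by rewrite (take_slice _ _ (leqnSn _)) -(size_rcons v' x) fv -cats1 take_size_cat.
Qed.

(** Mirror image, with the first letter of [v] in place of the last. *)
Lemma subseq_after_factor v c d e f : factor_word v -> f < c -> 
  f + size v <= d -> slice f (f + size v) = v ->
  subseq (word_pow v e) (slice c d) ->
  subseq (word_pow v e) (slice (f + size v) d).
Proof.
case/andP; case: v => // x v' _ /andP[xv' _] cf dv fv vsub.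
apply: (word_pow_head xv'); apply: (subseq_trans vsub).
apply: (@subseq_trans _ (slice f.+1 d)); first exact: slice_subseq.
rewrite (@slice_cat _ z f.+1 (f + size (x :: v'))) //=; last by lia.
rewrite (_ : slice f.+1 _ = v') //.
by rewrite -behead_slice fv.
Qed.

(** If [s = l], the power alone suffices. Otherwise take an occurrence of the factor [v] in the
    block. If it ends by [d'], the block may be cut at [d']. If not, the power lies before it and
    the occurrence supplies one more copy of [v]. *)
Lemma heavy_overlap_left v c c' d d' s :
  factor_word v -> d' <= c' -> heavy v (slice c c') s ->
  subseq (word_pow v s) (slice d d') ->
  heavy v (slice (minn c d) d') s \/
  (s < l /\ heavy v (slice (minn c d) c') s.+1).
Proof.
move=> vP d'c' hx vsub.
have vsub' : subseq (word_pow v s) (slice (minn c d) d').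
  by apply: subseq_trans vsub (slice_subseq _ _ _); rewrite ?geq_minr.
have hx' : heavy v (slice (minn c d) c') s.
  by apply: heavy_infix hx; rewrite slice_infix ?geq_minl.
case: (hx) => [[sl _]|[sl /infix_sliceP vx _]].
  by left; left; rewrite -{2}sl.
have [f [cf fc' fv]] := vx (proj1 (andP vP)).
have mf : minn c d <= f by rewrite geq_min cf.
have [fd'|d'f] := leqP (f + size v) d'.
  left; right; split=> //; rewrite -[X in infix X]fv slice_infix //.
right; split=> //; apply: (heavy_pow _ sl hx') => //.
rewrite word_powSr (@slice_cat _ z _ f) //; last by lia.
rewrite (@slice_cat _ z f (f + size v)) ?leq_addr // fv cat_subseq ?prefix_subseq //.
exact: subseq_before_factor vsub'.
Qed.

Lemma heavy_overlap_right v c c' d d' s :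
  factor_word v -> c <= d -> c <= c' -> heavy v (slice c c') s ->
  subseq (word_pow v s) (slice d d') ->
  heavy v (slice d (maxn c' d')) s \/
  (s < l /\ heavy v (slice c (maxn c' d')) s.+1).
Proof.
move=> vP cd cc' hx vsub.
have vsub' : subseq (word_pow v s) (slice d (maxn c' d')).
  by apply: subseq_trans vsub (slice_subseq _ _ _); rewrite ?leq_maxr.
have hx' : heavy v (slice c (maxn c' d')) s.
  by apply: heavy_infix hx; rewrite slice_infix ?leq_maxl.
case: (hx) => [[sl _]|[sl /infix_sliceP vx _]].
  by left; left; rewrite -{2}sl.
have [f [cf fc' fv]] := vx (proj1 (andP vP)).
have fm : f + size v <= maxn c' d' by rewrite leq_max fc'.
have [df|fd] := leqP d f.
  left; right; split=> //; rewrite -[X in infix X]fv slice_infix //.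
right; split=> //; apply: (heavy_pow _ sl hx') => //.
rewrite word_powS (@slice_cat _ z _ f) //; last by lia.
rewrite (@slice_cat _ z f (f + size v)) ?leq_addr //.
rewrite fv; apply: (subseq_trans _ (suffix_subseq _ _)).
by rewrite subseq_cat2l; apply: subseq_after_factor vsub'.
Qed.

(** Letters after the last cut are unconstrained: the last block can absorb them, since [heavy]
    passes to longer words. *)
Fixpoint heavy_cuts vs js c :=
  match vs, js with
  | [::], [::] => True
  | v :: vs, j :: js =>
      exists c', [/\ c <= c', heavy v (slice c c') j & heavy_cuts vs js c']
  | _, _ => False
  end.

Fixpoint power_cuts vs js c :=
  match vs, js with
  | [::], [::] => True
  | v :: vs, j :: js =>
      exists c', [/\ c <= c', subseq (word_pow v j) (slice c c') &
        power_cuts vs js c']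
  | _, _ => False
  end.

Definition heavier vs c n := exists js, heavy_cuts vs js c /\ n <= sumn js.

Lemma heavier_cons v vs c c' s n : c <= c' -> heavy v (slice c c') s ->
  heavier vs c' n -> heavier (v :: vs) c (s + n).
Proof.
move=> cc' hv [js [hjs nj]]; exists (s :: js); split; last by rewrite leq_add2l.
by exists c'.
Qed.

(* By induction, comparing the first cut c' of the factorization with the first
   cut d' of the embedded powers. *)
Lemma heavy_cuts_exchange vs js js' c d :
  all factor_word vs -> heavy_cuts vs js c -> power_cuts vs js' d ->
  all2 leq js js' -> all (leq^~ l) js' ->
  (js <> js' -> heavier vs (minn c d) (sumn js).+1) /\
  (c <= d -> heavier vs d (sumn js) \/ heavier vs c (sumn js).+1).
Proof.
elim: vs js js' c d => [|v vs IHvs] [|s js] [|s' js'] //= c d.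
  by split=> // _; left; exists [::].
case/andP=> vP vsP [c' [cc' hx hvs]] [d' [dd' vx pvs]] /andP[ss' jj'] /andP[s'l lj'].
have [IHI IHC] := IHvs _ _ _ _ vsP hvs pvs jj' lj'.
have vsx : subseq (word_pow v s) (slice d d').
  exact: subseq_trans (subseq_word_pow _ ss') vx.
have hvs0 : heavier vs c' (sumn js) by exists js.
have hx0 : heavy v (slice (minn c d) c') s.
  by apply: heavy_infix hx; rewrite slice_infix ?geq_minl.
have mc' : minn c d <= c' by rewrite geq_min cc'.
have md' : minn c d <= d' by rewrite geq_min dd' orbT.
split=> [neq|cd].
  (* If the tails differ, the tail gains weight by induction, starting from the smaller of [c'] and
     [d']. Only when this is [d'] must the first block be shortened. *)
  have [eqjs|/eqP neqjs] := eqVneq js js'; last first.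
    have := IHI neqjs; have [c'd'|d'c'] := leqP c' d' => hvs1.
      by rewrite -addnS; apply: (heavier_cons _ hx0).
    have [hy|[sl hy]] := heavy_overlap_left vP (ltnW d'c') hx vsx.
      by rewrite -addnS; apply: (heavier_cons _ hy).
    by rewrite -addSn; apply: (heavier_cons _ hy).
  (* Equal tails force $s < s'$: the first block, extended to the larger of [c'] and [d'], gains a
     copy of [v]. If its end moves to [d'], the second claim moves the tail as well or makes it
     heavier. *)
  have {neq}ss'' : s < s'.
    by rewrite ltn_neqAle ss' andbT; apply/eqP => es; apply: neq; rewrite es eqjs.
  have sl : s < l by apply: leq_trans s'l.
  have hy : heavy v (slice (minn c d) (maxn c' d')) s.+1.
    apply: (heavy_pow _ sl (heavy_infix _ hx)); rewrite ?leqnSn //.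
      by rewrite slice_infix ?geq_minl ?leq_maxl.
    apply: subseq_trans (subseq_word_pow _ ss'') _; apply: (subseq_trans vx).
    by rewrite slice_subseq ?geq_minr ?leq_maxr.
  move: hy; have [d'c'|c'd'] := leqP d' c' => hy.
    by rewrite -addSn; apply: (heavier_cons _ hy).
  have [hvs1|hvs1] := IHC (ltnW c'd').
    by rewrite -addSn; apply: (heavier_cons _ hy).
  by rewrite -addnS; apply: (heavier_cons _ hx0).
(* For the second claim, the first block is pushed to start at [d]. If its end moves to [d'], the
   tail is pushed too; any failure to move yields extra weight. *)
have := heavy_overlap_right vP cd cc' hx vsx.
have [d'c'|c'd'] := leqP d' c'.
  case=> [hy|[sl hy]]; [left|right].
    exact: (heavier_cons (leq_trans dd' d'c') hy).
  by rewrite -addSn; apply: (heavier_cons _ hy).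
have [hvs1|hvs1] := IHC (ltnW c'd').
  case=> [hy|[sl hy]]; [left|right].
    exact: (heavier_cons _ hy).
  by rewrite -addSn; apply: (heavier_cons _ hy) => //; lia.
by move=> _; right; rewrite -addnS; apply: (heavier_cons _ hx).
Qed.

Lemma heavy_cuts_weights vs js c : heavy_cuts vs js c ->
  size js = size vs /\ all (leq^~ l) js.
Proof.
elim: vs js c => [|v vs IHvs] [|s js] //= c [c' [_ hv /IHvs[-> ->]]].
by split=> //; rewrite andbT; case: hv => [[-> _]|[/ltnW]].
Qed.

Lemma sumn_incr_nth js i : sumn (incr_nth js i) = (sumn js).+1.
Proof.
elim: js i => [|j js IHjs] [|i] //=; last by rewrite IHjs addnS.
by rewrite sumn_ncons mul0n.
Qed.

Lemma all2_leq_incr_nth js i : i < size js -> all2 leq js (incr_nth js i).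
Proof.
have all2_refl js1 : all2 leq js1 js1 by elim: js1 => //= j js1 ->; rewrite leqnn.
by elim: js i => [|j js IHjs] [|i] //= ijs; rewrite ?leqnSn ?leqnn /= ?all2_refl ?IHjs.
Qed.

Lemma all_leq_incr_nth js i : i < size js -> nth 0 js i < l ->
  all (leq^~ l) js -> all (leq^~ l) (incr_nth js i).
Proof.
by elim: js i => [|j js IHjs] [|i] //= ijs il /andP[jl lj]; rewrite ?il ?jl //= IHjs.
Qed.

(** Weights are at most [l], so some factorization has maximal total weight. An embedding with one
    exponent raised would, by the exchange from [c = d = 0], produce a heavier one. *)
Lemma heavy_cuts_max vs js : all factor_word vs -> heavy_cuts vs js 0 ->
  exists2 js', heavy_cuts vs js' 0 &
    forall i, i < size vs -> nth 0 js' i < l -> ~ power_cuts vs (incr_nth js' i) 0.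
Proof.
move=> vsP hjs.
have heavier_bound n : heavier vs 0 n -> n <= l * size vs.
  move=> [js1 [/heavy_cuts_weights[<- lj] nj]]; apply: (leq_trans nj).
  elim: js1 lj {nj} => [|j js1 IH] //= /andP[jl /IH]; rewrite mulnS; exact: leq_add.
have exn : exists n, `[< heavier vs 0 n >].
  by exists (sumn js); apply/asboolP; exists js.
have bn n : `[< heavier vs 0 n >] -> n <= l * size vs by move/asboolP/heavier_bound.
case: (ex_maxnP exn bn) => n /asboolP[js' [hjs' nj']] nmax.
exists js' => // i ivs il pow; have [sj' lj'] := heavy_cuts_weights hjs'.
have [] := heavy_cuts_exchange vsP hjs' pow.
- by rewrite all2_leq_incr_nth ?sj'.
- by rewrite all_leq_incr_nth ?sj'.
rewrite minnn => h _.
have /h hS : js' <> incr_nth js' i by move/(congr1 sumn); rewrite sumn_incr_nth; lia.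
by have /asboolP/nmax := hS; lia.
Qed.

(** * Threshold languages in terms of cuts *)

Lemma threshold_factorP v x :
  threshold_factor l v x <-> infix v x \/ subseq (word_pow v l) x.
Proof.
split=> [[[_ [y [[p [_ [_ -> ->]]] _ ->]]]|]|[/infixP[p [q ->]]|]].
- by left; rewrite -catA infix_infix.
- by right.
- by left; exists (p ++ v), q; split=> //; [exists p, v | rewrite catA].
- by right.
Qed.

Lemma threshold_factors_cuts vs c : 0 < l ->
  threshold_factors l vs (drop c z) -> exists js, heavy_cuts vs js c.
Proof.
move=> l0; elim: vs c => [|v vs IHvs] c; first by exists [::].
move=> [x [y [vx vsy defz]]].
have sx : slice c (c + size x) = x by rewrite /slice addKn defz take_size_cat.
have : drop (c + size x) z = y by rewrite addnC -drop_drop defz drop_size_cat.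
move: vsy => /[swap] <- /IHvs[js hjs].
(* A block containing the factor [v] gets weight 0, which is below [l]; one containing $v^l$ gets
   weight [l]. *)
case/threshold_factorP: vx => vx; [exists (0 :: js) | exists (l :: js)];
  exists (c + size x); rewrite leq_addr sx; split=> //; [right|left]; split=> //.
exact: sub0seq.
Qed.

Lemma cuts_threshold_factors vs js c : vs != [::] ->
  heavy_cuts vs js c -> threshold_factors l vs (drop c z).
Proof.
elim: vs js c => // v vs IHvs [|j js] // c _ [c' [cc' hv hvs]].
have vx : threshold_factor l v (slice c c').
  by apply/threshold_factorP; case: hv => [[_]|[_]]; [right|left].
rewrite (drop_slice _ cc'); case: vs IHvs hvs => [|v' vs] IHvs hvs; last first.
  by exists (slice c c'), (drop c' z); split=> //; exact: IHvs hvs.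
(* The last block takes all remaining letters. *)
exists (slice c c' ++ drop c' z), [::]; rewrite cats0; split=> //.
apply/threshold_factorP; case/threshold_factorP: vx => vx; [left|right].
  exact: infix_catr.
exact: (subseq_trans vx (prefix_subseq _ _)).
Qed.

Fixpoint pow_word vs js : seq T :=
  match vs, js with
  | v :: vs, j :: js => word_pow v j ++ pow_word vs js
  | _, _ => [::]
  end.

Lemma power_cutsP vs js c : size js = size vs ->
  power_cuts vs js c <-> subseq (pow_word vs js) (drop c z).
Proof.
elim: vs js c => [|v vs IHvs] [|j js] //= c; first by rewrite sub0seq.
case=> sj; split=> [[c' [cc' vc /(IHvs _ _ sj) vsc]]|].
  by rewrite (drop_slice _ cc') cat_subseq.
move=> /cat_subseq_split[k vk vsk]; exists (c + k); split; first exact: leq_addr.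
  by rewrite /slice addKn.
by apply/IHvs; rewrite // addnC -drop_drop.
Qed.

End Exchange.

Arguments factor_word {T} v.

(** * Readings with delays *)

(** Meant for the positions of the successive letters of a word. No level is visited twice, so once
    the sequence fails to climb by one it stays below its initial value, contrary to where it
    ends. *)
Lemma staircase (m : nat) (f : nat -> nat) :
  (forall s, s.+1 < m -> f s.+1 <= (f s).+1) ->
  (forall s t, s < m -> t < m -> f s = f t -> s = t) ->
  f 0 <= f m.-1 -> forall s, s < m -> f s = f 0 + s.
Proof.
move=> fS finj f0m s.
have [n sn] := ubnP s; elim: n s sn => // n IHn [|s]; first by rewrite addn0.
rewrite ltnS => sn sm; apply/eqP; rewrite eqn_leq; apply/andP; split.
  by rewrite addnS -(IHn s) ?fS // ltnW.
rewrite leqNgt; apply/negP => fs.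
(* A drop falls below [f 0], and by injectivity [f] can never climb back. *)
have below t : s < t -> t < m -> f t < f 0.
  elim: t => // t IHt; rewrite ltnS leq_eqVlt => /predU1P[<- _|st tm].
    rewrite ltnNge; apply/negP => f0s.
    have sl : f s.+1 - f 0 < s.+1 by lia.
    have := IHn (f s.+1 - f 0) (leq_trans sl sn) (ltn_trans sl sm).
    by rewrite subnKC // => /finj; move/(_ (ltn_trans sl sm) sm); lia.
  have ft := IHt st (ltnW tm); have := fS t tm.
  rewrite ltn_neqAle => ftS; rewrite (leq_trans ftS ft) andbT.
  by apply/eqP => /finj; move/(_ tm (leq_ltn_trans (leq0n t) (ltnW tm))).
by have := below m.-1; lia.
Qed.

Section Probes.
Variables (T : finType) (z : seq T).
Implicit Types (v s : seq T) (ps : seq (nat * nat)) (p q : nat * nat).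
Local Notation slice := (slice z).

(* A pair (i, d) stands for reading position i with delay d, at time i + d. *)
Definition read_lt p q :=
  (p.1 + p.2 < q.1 + q.2) || ((p.1 + p.2 == q.1 + q.2) && (p.2 < q.2)).

Lemma read_lt_trans : transitive read_lt.
Proof. by move=> [a b] [c d] [e f]; rewrite /read_lt /=; lia. Qed.

Lemma read_lt_irr : irreflexive read_lt.
Proof. by move=> [a b]; rewrite /read_lt /=; lia. Qed.

Definition reads ps (tau : seq (nat * T)) :=
  sorted read_lt ps /\
  [seq (p.2, onth z p.1) | p <- ps] = [seq (t.1, Some t.2) | t <- tau].

Definition delayed (d : nat) s : seq (nat * T) := [seq (d, a) | a <- s].

Lemma reads_cat ps qs tau sigma k :
  reads ps tau -> reads qs sigma ->
  all (fun p => p.1 + p.2 < k) ps -> all (fun q => k <= q.1 + q.2) qs ->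
  reads (ps ++ qs) (tau ++ sigma).
Proof.
move=> [psS pst] [qsS qst] /allP psk /allP qsk; split; last by rewrite !map_cat pst qst.
rewrite (sorted_pairwise read_lt_trans) pairwise_cat.
rewrite -!(sorted_pairwise read_lt_trans) psS qsS !andbT.
apply/allrelP => p q /psk pk /qsk qk.
by rewrite /read_lt (leq_trans pk qk).
Qed.

Lemma reads_catP ps tau sigma : reads ps (tau ++ sigma) ->
  exists ps1 ps2, [/\ ps = ps1 ++ ps2, reads ps1 tau, reads ps2 sigma &
    allrel read_lt ps1 ps2].
Proof.
move=> [psS pst]; exists (take (size tau) ps), (drop (size tau) ps).
rewrite cat_take_drop; move: psS.
rewrite -{1}(cat_take_drop (size tau) ps) (sorted_pairwise read_lt_trans).
rewrite pairwise_cat -!(sorted_pairwise read_lt_trans) => /and3P[rel s1 s2].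
split=> //; split=> //; rewrite ?map_take ?map_drop pst map_cat.
  by rewrite take_size_cat ?size_map.
by rewrite drop_size_cat ?size_map.
Qed.

Lemma reads_delay ps d s : reads ps (delayed d s) -> all (fun p => p.2 == d) ps.
Proof.
move=> [_ pst]; apply/allP => p pps; have := map_f (fun p => (p.2, onth z p.1)) pps.
by rewrite pst -map_comp => /mapP[a _ [->]].
Qed.

Lemma reads_size ps tau : reads ps tau -> size ps = size tau.
Proof. by move=> [_ /(congr1 size)]; rewrite !size_map. Qed.

Lemma slice1 i a : onth z i = Some a -> slice i i.+1 = [:: a].
Proof.
move=> zi; have iz : i < size z by rewrite -onthTE zi.
by rewrite /slice subSnn (drop_nth a iz) /= take0 (@onth_nth _ a _ _ _ zi).
Qed.

(** Under a common delay, [read_lt] orders readings by position. *)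
Lemma reads_subseq ps d s c c' : reads ps (delayed d s) ->
  all (fun p => c <= p.1 < c') ps -> subseq s (slice c c').
Proof.
elim: s ps c => [|a s IHs] [|p ps] c; rewrite ?sub0seq //; first by case.
move=> psr /= /andP[/andP[cp pc'] psc']; case: (psr) => psS /= [pd zp pst].
rewrite (@slice_cat _ z c p.1.+1) ?(@slice_cat _ z c p.1 p.1.+1) //; last by lia.
rewrite (slice1 zp) -cat1s cat_subseq //; first exact: suffix_subseq.
have psr' : reads ps (delayed d s) by split=> //; apply: path_sorted psS.
apply: (IHs ps) => //; apply/allP => q qps; move/allP/(_ q qps): psc' => /andP[_ ->].
have := reads_delay psr' => /allP/(_ q qps)/eqP qd.
have := order_path_min read_lt_trans psS => /allP/(_ q qps).
by rewrite /read_lt pd qd andbT; lia.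
Qed.

Lemma subseq_reads d s c c' : subseq s (slice c c') ->
  exists2 ps, reads ps (delayed d s) & all (fun p => c <= p.1 < c') ps.
Proof.
move=> /subseqP[m sm ->]; set k := size (slice c c') in sm *.
pose ps := [seq (i, d) | i <- iota c k].
have psS : sorted read_lt ps.
  rewrite sorted_map (@eq_sorted _ _ ltn); first exact: iota_ltn_sorted.
  by move=> i j; rewrite /relpre /read_lt /=; lia.
exists (mask m ps).
  split; first exact: subseq_sorted read_lt_trans _ _ (mask_subseq _ _) psS.
  rewrite /delayed !map_mask -!map_comp; congr (mask m _).
  rewrite (map_comp (pair d) (onth z)) [RHS](map_comp (pair d) Some); congr map.
  apply: (@eq_from_nth _ None) => [|i]; rewrite size_map size_iota ?size_map // => ik.
  rewrite (nth_map 0) ?size_iota // nth_iota // onthE /slice map_take map_drop.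
  by rewrite nth_take ?nth_drop // (leq_trans ik) ?size_slice.
apply/allP => p /mem_mask /mapP[i]; rewrite mem_iota => /andP[ci ick] -> /=.
by have := size_slice z c c'; rewrite -/k ci; lia.
Qed.

End Probes.

Lemma subseq_drop (T : eqType) k (s1 s2 : seq T) :
  subseq s1 s2 -> subseq (drop k s1) (drop k s2).
Proof.
elim: k s1 s2 => [|k IHk] [|a s1] [|b s2] //=; rewrite ?drop0 ?sub0seq //.
by case: eqVneq => _ sub; apply: IHk => //; apply: cons_subseq sub.
Qed.

(** * Probing for a single factor *)

Section FactorProbes.
Variables (T : finType) (z : seq T).
Implicit Types (v s : seq T) (ps : seq (nat * nat)) (p q : nat * nat).
Local Notation slice := (slice z).
Local Notation reads := (reads z).

(* The central part reads v backwards, each letter with one more unit of delay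
   than the previous one: this allows the read positions to decrease, but by at
   most one at each step. *)
Definition factor_probe v a b d :=
  delayed d (word_pow v a ++ take (size v).-1 v) ++
  zip (iota d (size v)) (rev v) ++
  delayed (d + (size v).-1) (behead v ++ word_pow v b).

Lemma read_lt_last p0 ps p : sorted read_lt (p0 :: ps) -> p \in p0 :: ps ->
  (p == last p0 ps) || read_lt p (last p0 ps).
Proof.
rewrite (sorted_pairwise read_lt_trans) lastI pairwise_rcons => /andP[+ _].
by rewrite mem_rcons inE => /allP h /predU1P[->|/h ->]; rewrite ?eqxx ?orbT.
Qed.

Lemma reads_zip_iota ps d s x0 i : reads ps (zip (iota d (size s)) s) ->
  i < size s -> (nth (0, 0) ps i).2 = d + i /\
    onth z (nth (0, 0) ps i).1 = Some (nth x0 s i).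
Proof.
move=> [_ pst] im; have sps : size ps = size s.
  by have := congr1 size pst; rewrite !size_map size_zip size_iota minnn.
have := congr1 (fun l => nth (0, None) l i) pst.
rewrite (nth_map (0, 0)) ?sps // (nth_map (0, x0)) ?size_zip ?size_iota ?minnn //.
by rewrite nth_zip ?size_iota // nth_iota // => -[-> ->].
Qed.

(** Let [q] and [r] be the positions where the central part reads the last and the first letter of
    [v]. If [q < r], the copies ending at [q] and those starting at [r] make $v^{a+b+2}$. If
    [r <= q], [staircase] turns the central readings into a factor [v]. The clause on later readings
    lets probes be chained, [c'] being just past the position of the last reading. *)
Lemma factor_probe_sound v a b d c ps :
  factor_word v -> reads ps (factor_probe v a b d) ->
  (forall p, p \in ps -> p.2 = d -> c <= p.1) ->
  exists c', [/\ c <= c',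
    forall q, all (read_lt^~ q) ps -> q.2 = d + (size v).-1 -> c' <= q.1 &
    (infix v (slice c c') /\ subseq (word_pow v (a + b).+1) (slice c c')) \/
    subseq (word_pow v (a + b).+2) (slice c c')].
Proof.
case/andP; case: v => // x0 v0 _; set v := x0 :: v0; set n := size v0 => vu.
have szv : size v = n.+1 by [].
move=> /reads_catP[psA [psMB [-> rA + relA]]] cps.
case/reads_catP=> psM [psB [defMB rM rB relB]]; rewrite szv -[n.+1.-1]/n in rA rB *.
have szM : size psM = n.+1.
  by rewrite (reads_size rM) size_zip size_iota size_rev minnn.
pose g t := nth (0, 0) psM t.
have gP t : t <= n -> (g t).2 = d + t /\ onth z (g t).1 = Some (nth x0 v (n - t)).
  move=> tn; have := @reads_zip_iota psM d (rev v) x0 t.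
  by rewrite size_rev nth_rev ?szv // subSS => /(_ rM tn).
have gin t : t <= n -> g t \in psM by move=> tn; rewrite mem_nth ?szM.
(* Time cannot decrease while the delay grows by one, so the position falls by at most one. *)
have gS t : t < n -> (g t).1 <= (g t.+1).1.+1.
  move=> tn; case: rM => /(sortedP (0, 0))/(_ t); rewrite szM ltnS => /(_ tn) + _.
  rewrite -/(g t) -/(g t.+1) /read_lt (proj1 (gP t (ltnW tn))) (proj1 (gP _ tn)); lia.
set q := (g 0).1; set r := (g n).1.
have zq : onth z q = Some (nth x0 v n) by have [] := gP 0 (leq0n n); rewrite subn0.
have zr : onth z r = Some x0 by have [] := gP n (leqnn n); rewrite subnn.
have cq : c <= q.
  apply: cps; last by have [-> _] := gP 0 (leq0n n); rewrite addn0.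
  by rewrite mem_cat defMB mem_cat gin ?orbT.
have Aq : subseq (word_pow v a ++ take n v) (slice c q).
  apply: (reads_subseq rA); apply/allP => p pA.
  have /allP/(_ p pA)/eqP pd := reads_delay rA.
  rewrite cps ?mem_cat ?pA //=.
  have := allrelP relA p (g 0) pA; rewrite defMB mem_cat gin // => /(_ isT).
  by rewrite /read_lt pd (proj1 (gP 0 _)) // /q; lia.
(* The letter read at [q] completes the truncated copy of [v] read before it. *)
have Aq1 : subseq (word_pow v a.+1) (slice c q.+1).
  rewrite (@slice_cat _ z c q) // (slice1 zq) word_powSr.
  rewrite -[X in word_pow v a ++ X](cat_take_drop n) catA cat_subseq //.
  by rewrite (drop_nth x0) ?szv // drop_oversize ?szv.
set e := last (g n) psB; exists e.1.+1.
have gB : all (read_lt (g n)) psB.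
  by apply/allP => p pB; apply: (allrelP relB) => //; apply: gin.
have sB : sorted read_lt (g n :: psB).
  rewrite (sorted_pairwise read_lt_trans) /= gB -(sorted_pairwise read_lt_trans).
  by case: rB.
have dB p : p \in g n :: psB -> p.2 = d + n.
  rewrite inE => /predU1P[->|pB]; first by have [] := gP n (leqnn n).
  by have /allP/(_ p pB)/eqP := reads_delay rB.
have ein : e \in g n :: psB by apply: mem_last.
have le_e p : p \in g n :: psB -> p.1 <= e.1.
  move=> pin; have /predU1P[-> //|] := read_lt_last sB pin.
  by rewrite /read_lt -/e (dB _ pin) (dB _ ein); lia.
have re : r <= e.1 by apply: le_e; rewrite mem_head.
have Br : subseq (behead v ++ word_pow v b) (slice r.+1 e.1.+1).
  apply: (reads_subseq rB); apply/allP => p pB.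
  have pin : p \in g n :: psB by rewrite inE pB orbT.
  rewrite ltnS le_e // andbT; have := allP gB p pB.
  by rewrite /read_lt (dB _ pin) (dB (g n)) ?mem_head // /r; lia.
have nextP p : all (read_lt^~ p) (psA ++ psMB) -> p.2 = d + n -> e.1 < p.1.
  move=> /allP/(_ e) lte pd; have := lte; rewrite /read_lt pd (dB _ ein).
  have -> : e \in psA ++ psMB.
    rewrite mem_cat defMB mem_cat; move: ein; rewrite inE => /predU1P[->|->].
      by rewrite gin ?orbT.
    by rewrite !orbT.
  by move=> /(_ isT); lia.
have szA := leq_trans (size_subseq Aq) (size_slice _ _ _).
rewrite size_cat size_take szv ltnSn in szA.
have szB := leq_trans (size_subseq Br) (size_slice _ _ _).
rewrite size_cat /= -/n in szB.
have [rq|qr] := leqP r q; last first.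
  split=> //; [lia | right].
  rewrite (_ : (a + b).+2 = a.+1 + b.+1); last by rewrite addnS.
  rewrite word_powD.
  rewrite (@slice_cat _ z c q.+1); [|lia|lia].
  rewrite cat_subseq // (@slice_cat _ z q.+1 r); [|lia|lia].
  rewrite (@slice_cat _ z r r.+1) // (slice1 zr) word_powS.
  by apply: subseq_trans (suffix_subseq _ _); rewrite /= eqxx.
(* Undoing the reversal, [f i] is where the letter of index [i] in [v] is read; distinct letters
   have distinct positions. *)
pose f i := (g (n - i)).1.
have zf i : i <= n -> onth z (f i) = Some (nth x0 v i).
  by move=> sn; have [_] := gP (n - i) (leq_subr _ _); rewrite subKn.
have fE i : i <= n -> f i = r + i.
  rewrite -ltnS (_ : r = f 0); last by rewrite /f subn0.
  apply: (@staircase n.+1 f).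
  - move=> t tn; have := gS (n - t.+1); rewrite /f -subSn ?subSS //; apply; lia.
  - move=> t u tn un ftu; have := zf t tn; rewrite ftu zf // => -[].
    by move/eqP; rewrite nth_uniq // => /eqP.
  - by rewrite /f /= subn0 subnn -/r -/q.
have qE : q = r + n by rewrite -fE // /f subnn.
have rv : slice r (r + size v) = v.
  have sz : size (slice r (r + size v)) = size v.
    have qz : q < size z by rewrite -onthTE zq.
    by rewrite /slice addKn size_takel // size_drop szv; lia.
  apply: (@eq_from_nth _ x0) => // i; rewrite sz szv ltnS => iv.
  have := zf i iv; rewrite fE // => zri.
  rewrite /slice addKn nth_take ?szv // nth_drop.
  exact: (@onth_nth _ x0 _ _ _ zri).
have vin : infix v (slice c e.1.+1).
  rewrite -[X in infix X]rv slice_infix // ?szv; lia.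
split=> //; [lia | left; split=> //].
rewrite -addSn word_powD (@slice_cat _ z c q.+1); [|lia|lia].
rewrite cat_subseq //.
(* The [n] letters of [behead v] use up at least the [n] positions from [r.+1] to [q], so $v^b$ fits
   beyond [q]. *)
have := subseq_drop n Br; rewrite drop_size_cat //.
rewrite /slice (_ : e.1.+1 - r.+1 = (e.1.+1 - q.+1) + n); last by lia.
by rewrite -take_drop drop_drop addnS addnC -qE.
Qed.

End FactorProbes.

(** * Probing for a sequence of words *)

Section ProbeSequences.
Variables (T : finType) (z : seq T).
Implicit Types (v : seq T) (vs : seq (seq T)) (js ks : seq nat).
Implicit Types (ps : seq (nat * nat)).
Local Notation slice := (slice z).
Local Notation reads := (reads z).

(** Only the copy of [v] that straddles the cut, or starts at it, is given up; this also pays for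
    the first letter of [s2]. *)
Lemma word_pow_cat_split v j s1 s2 : v != [::] -> word_pow v j = s1 ++ s2 ->
  exists2 a, a <= j & subseq (word_pow v a) s1 /\
    subseq (word_pow v (j.-1 - a)) (behead s2).
Proof.
move=> v0; elim: j s1 => [|j IHj] s1 vj; first by exists 0; rewrite // !sub0seq.
have [vs1|s1v] := leqP (size v) (size s1).
  have vs : take (size v) s1 = v.
    have := congr1 (take (size v)) vj.
    by rewrite word_powS take_size_cat // takel_cat.
  move: vj; rewrite -(cat_take_drop (size v) s1) vs -catA word_powS.
  move=> /eqP; rewrite eqseq_cat // eqxx => /eqP /IHj[a aj [va vb]].
  exists a.+1 => //; rewrite word_powS subseq_cat2l; split=> //.
  by rewrite (_ : j.+1.-1 - a.+1 = j.-1 - a) //; lia.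
exists 0 => //; split; first by rewrite sub0seq.
have -> : s2 = drop (size s1) v ++ word_pow v j.
  have := congr1 (drop (size s1)) vj.
  by rewrite word_powS drop_cat s1v drop_size_cat.
have : size (drop (size s1) v) > 0 by rewrite size_drop subn_gt0.
by case: (drop _ v) => //= x t _; rewrite subn0 suffix_subseq.
Qed.

Lemma onth_slice a b i : i < b - a -> onth (slice a b) i = onth z (a + i).
Proof.
by move=> iab; rewrite !onthE /slice map_take map_drop nth_take // nth_drop.
Qed.

(** Position and delay change in opposite directions, so all letters of the factor are read at the
    same time; the order by delay then lists them backwards. *)
Lemma reads_backwards d v f : v != [::] -> slice f (f + size v) = v ->
  exists2 ps, reads ps (zip (iota d (size v)) (rev v)) &
    all (fun p => p.1 + p.2 == f + (size v).-1 + d) ps.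
Proof.
move=> v0 fv; have x0 : T by case: (v) v0.
have [n szv] : exists n, size v = n.+1 by case: (v) v0 => // x t _; exists (size t).
rewrite szv in fv *.
pose ps := [seq (f + (n - t), d + t) | t <- iota 0 n.+1]; exists ps; last first.
  apply/allP => p /mapP[t]; rewrite mem_iota add0n ltnS => /= tn -> /=.
  by rewrite addnACA subnK // addnAC.
split.
  apply/(sortedP (0, 0)) => i; rewrite size_map size_iota => iSn.
  rewrite !(nth_map 0) ?size_iota ?(ltnW iSn) // !nth_iota ?(ltnW iSn) //.
  by rewrite /read_lt /= !add0n; clear -iSn; lia.
apply: (@eq_from_nth _ (0, None)) => [|i].
  by rewrite !size_map size_zip !size_iota size_rev szv minnn.
rewrite !size_map size_iota => iSn.
rewrite -map_comp (nth_map 0) ?size_iota // nth_iota // [LHS]/= add0n.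
rewrite (nth_map (0, x0)) ?size_zip ?size_iota ?size_rev ?szv ?minnn //.
rewrite nth_zip ?size_iota ?size_rev ?szv // nth_iota // nth_rev ?szv //=.
rewrite subSS -(@onth_slice f (f + n.+1)) ?addKn ?ltnS ?leq_subr // fv.
by rewrite onthE (nth_map x0) // szv ltnS leq_subr.
Qed.

(** Cutting the power just before the last letter of an occurrence of [v] leaves copies on both
    sides of this occurrence, which replaces the one copy lost. The three parts of the probe are
    read before, at and after time [f + n + d]. *)
Lemma factor_probe_complete v j d c c' : factor_word v ->
  infix v (slice c c') -> subseq (word_pow v j) (slice c c') ->
  exists2 a, a <= j & exists2 ps, reads ps (factor_probe v a (j.-1 - a) d) &
    all (fun p => c + d <= p.1 + p.2 < c' + (d + (size v).-1)) ps.
Proof.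
move=> vP; have /andP[v0 vu] := vP; move=> /(infix_sliceP v0)[f [cf fc' fv]] vj.
have [n szv] : exists n, size v = n.+1 by case: (v) v0 => // x t _; exists (size t).
have fv0 := fv; rewrite szv in fc' fv *.
have fnv : slice f (f + n) = take n v by rewrite (take_slice _ _ (leqnSn n)) fv.
have fSv : slice f.+1 (f + n.+1) = behead v by rewrite -behead_slice fv.
move: vj; rewrite (@slice_cat _ z c (f + n)) ?leq_addr //; [|lia|lia].
case/subseq_cat_split => s1 [s2 [/(word_pow_cat_split v0)[a aj [va vb]] s1c s2c]].
have {s1c} va : subseq (word_pow v a) (slice c f).
  apply: (@subseq_before_factor _ _ _ _ (f + n)) => //; rewrite ?szv //; first by lia.
  exact: subseq_trans s1c.
have {s2c} vb : subseq (word_pow v (j.-1 - a)) (slice (f + n.+1) c').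
  apply: (subseq_trans vb); have := subseq_drop 1 s2c; rewrite !drop1.
  have [k ck] : exists k, c' = f + n + k.+1 by exists (c' - (f + n.+1)); lia.
  by rewrite ck behead_slice (addnS f n).
exists a => //.
have A : subseq (word_pow v a ++ take n v) (slice c (f + n)).
  by rewrite (@slice_cat _ z c f) ?leq_addr // fnv cat_subseq.
have B : subseq (behead v ++ word_pow v (j.-1 - a)) (slice f.+1 c').
  by rewrite (@slice_cat _ z f.+1 (f + n.+1)) ?fSv ?cat_subseq //; lia.
have [psA rA pA] := subseq_reads d A; have [psB rB pB] := subseq_reads (d + n) B.
have dA := reads_delay rA; have dB := reads_delay rB.
have [psM rM kM] := reads_backwards d v0 fv0.
have nE : (size v).-1 = n by rewrite szv.
rewrite nE in kM; clear -cf fc' rA pA dA rM kM rB pB dB nE.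
exists (psA ++ psM ++ psB).
  rewrite /factor_probe nE; apply: (reads_cat (k := f + n + d) rA);
    first apply: (reads_cat (k := f + n + d + 1) rM).
  - exact: rB.
  - by apply/allP => p /(allP kM)/eqP ->; rewrite addn1.
  - apply/allP => p pin; move/allP/(_ p pin): pB; move/allP/(_ p pin)/eqP: dB; lia.
  - apply/allP => p pin; move/allP/(_ p pin): pA; move/allP/(_ p pin)/eqP: dA; lia.
  - rewrite all_cat; apply/andP; split; apply/allP => p pin.
      by move/allP/(_ p pin)/eqP: kM => ->.
    by move/allP/(_ p pin): pB; move/allP/(_ p pin)/eqP: dB; lia.
rewrite !all_cat; apply/and3P; split; apply/allP => p pin /=.
- by move/allP/(_ p pin): pA; move/allP/(_ p pin)/eqP: dA; lia.
- by move/allP/(_ p pin)/eqP: kM => ->; lia.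
- by move/allP/(_ p pin): pB; move/allP/(_ p pin)/eqP: dB; lia.
Qed.

Variable l : nat.
Hypothesis l_gt0 : 0 < l.

(** A factor probe hands its final delay to the next word. With [k] copies before the factor and
    [j.-1 - k] after it, at least [j] are seen in all. *)
Fixpoint probe vs js ks d :=
  match vs, js, ks with
  | v :: vs, j :: js, k :: ks =>
      if j == l then delayed d (word_pow v l) ++ probe vs js ks d
      else factor_probe v k (j.-1 - k) d ++ probe vs js ks (d + (size v).-1)
  | _, _, _ => [::]
  end.

(** Cuts and delays never decrease, so successive blocks occupy disjoint ranges of time and their
    readings concatenate. *)
Lemma probe_complete vs js c d : all factor_word vs -> heavy_cuts z l vs js c ->
  exists2 ks, size ks = size vs /\ all2 leq ks js &
  exists2 ps, reads ps (probe vs js ks d) & all (fun p => c + d <= p.1 + p.2) ps.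
Proof.
elim: vs js c d => [|v vs IHvs] [|j js] //= c d.
  by exists [::] => //; exists [::].
case/andP=> vP vsP [c' [cc' hv hvs]].
case: hv => [[-> vl]|[jl vx vj]].
  have [ks [szk kj] [ps rps kps]] := IHvs _ _ d vsP hvs.
  have [qs rqs pqs] := subseq_reads d vl; have dqs := reads_delay rqs.
  exists (0 :: ks); first by rewrite /= szk.
  rewrite eqxx; exists (qs ++ ps).
    apply: (reads_cat (k := c' + d) rqs rps) => //; apply/allP => p pin.
    by move/allP/(_ p pin): pqs; move/allP/(_ p pin)/eqP: dqs; lia.
  rewrite all_cat; apply/andP; split; apply/allP => p pin.
    by move/allP/(_ p pin): pqs; move/allP/(_ p pin)/eqP: dqs; lia.
  by move/allP/(_ p pin): kps; lia.
have [ks [szk kj] [ps rps kps]] := IHvs _ _ (d + (size v).-1) vsP hvs.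
have [a aj [qs rqs pqs]] := factor_probe_complete d vP vx vj.
exists (a :: ks); first by rewrite /= szk aj.
rewrite (ltn_eqF jl); exists (qs ++ ps).
  apply: (reads_cat (k := c' + (d + (size v).-1)) rqs rps) => //; apply/allP => p pin.
  by move/allP/(_ p pin): pqs; lia.
rewrite all_cat; apply/andP; split; apply/allP => p pin.
  by move/allP/(_ p pin): pqs; lia.
by move/allP/(_ p pin): kps; lia.
Qed.

(** Each block yields a cut. If every factor test finds its factor, the cuts are heavy. If one finds
    an extra copy instead, its exponent is raised; the power cuts, carried along for this purpose,
    supply the later blocks. *)
Lemma probe_sound vs js ks c d ps : all factor_word vs -> all (leq^~ l) js ->
  size js = size vs -> size ks = size vs ->
  reads ps (probe vs js ks d) -> (forall p, p \in ps -> p.2 = d -> c <= p.1) ->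
  power_cuts z vs js c /\
  (heavy_cuts z l vs js c \/
   exists i, [/\ i < size vs, nth 0 js i < l & power_cuts z vs (incr_nth js i) c]).
Proof.
elim: vs js ks c d ps => [|v vs IHvs] [|j js] [|k ks] //= c d ps.
  by move=> *; split=> //; left.
move=> /andP[vP vsP] /andP[jl lj] [sj] [sk]; have [-> {j jl}|jNl] := eqVneq j l.
  move=> /reads_catP[qs [ps' [-> rqs rps rel]]] cps.
  have dqs := reads_delay rqs.
  (* As [l] is positive and [v] nonempty, this block has a last reading, and the cut is placed just
     after it. *)
  case: qs rqs rel cps dqs => [|p0 qs] rqs rel cps dqs.
    have := reads_size rqs; rewrite size_map size_word_pow /= => /esym/eqP.
    by rewrite muln_eq0 size_eq0 gtn_eqF // (negPf (proj1 (andP vP))).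
  set e := last p0 qs; have ein : e \in p0 :: qs by apply: mem_last.
  have de p : p \in p0 :: qs -> p.2 = d by move=> pin; move/allP/(_ p pin)/eqP: dqs.
  have cq p : p \in p0 :: qs -> c <= p.1.
    by move=> pin; apply: cps (de _ pin); rewrite (mem_cat p (p0 :: qs)) pin.
  have vx : subseq (word_pow v l) (slice c e.1.+1).
    apply: (reads_subseq rqs); apply/allP => p pin.
    rewrite cq //=.
    have /predU1P[->|] := read_lt_last (proj1 rqs) pin; first by rewrite ltnSn.
    by rewrite -/e /read_lt (de _ pin) (de _ ein); lia.
  have ce : c <= e.1.+1 by apply: ltnW; rewrite ltnS cq.
  have [|pow hvs] := IHvs _ _ e.1.+1 _ _ vsP lj sj sk rps.
    move=> p pin pd; have := allrelP rel e p ein pin.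
    by rewrite /read_lt pd (de _ ein) ltnn andbF orbF ltn_add2r.
  split; first by exists e.1.+1.
  case: hvs => [hvs|[i [ivs il powi]]]; [left|right].
    by exists e.1.+1; split=> //; left.
  by exists i.+1; split=> //; exists e.1.+1.
move=> /reads_catP[qs [ps' [-> rqs rps rel]]] cps.
have [|c' [cc' nextP vx]] := factor_probe_sound vP rqs (c := c).
  by move=> p pin; apply: cps; rewrite mem_cat pin.
have [|pow hvs] := IHvs _ _ c' _ _ vsP lj sj sk rps.
  move=> p pin; apply: nextP; apply/allP => q qin; exact: (allrelP rel).
have {jl} jl : j < l by rewrite ltn_neqAle jNl.
have vj : subseq (word_pow v j) (slice c c').
  by case: vx => [[_]|]; apply: subseq_trans; apply: subseq_word_pow; lia.
split; first by exists c'.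
case: vx => [[vx _]|vx]; last first.
  right; exists 0; split=> //; exists c'; split=> //.
  by apply: subseq_trans vx; apply: subseq_word_pow; lia.
case: hvs => [hvs|[i [ivs il powi]]]; [left|right].
  by exists c'; split=> //; right.
by exists i.+1; split=> //; exists c'.
Qed.

(** Forwards, [js] comes from a factorization of maximal weight. Backwards, the absence of raised
    powers rules out the second outcome of [probe_sound]. *)
Lemma threshold_factors_probe vs : vs != [::] -> all factor_word vs ->
  threshold_factors l vs z <->
  exists js ks, [/\ size js = size vs, size ks = size vs, all (leq^~ l) js,
    all2 leq ks js &
    (exists ps, reads ps (probe vs js ks 0)) /\
    forall i, i < size vs -> nth 0 js i < l ->
      ~ exists ps, reads ps (delayed 0 (pow_word vs (incr_nth js i)))].
Proof.
move=> vs0 vsP.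
have powP js i : size js = size vs -> i < size vs ->
    power_cuts z vs (incr_nth js i) 0 <->
    exists ps, reads ps (delayed 0 (pow_word vs (incr_nth js i))).
  move=> sj ivs; rewrite power_cutsP ?size_incr_nth ?sj ?ivs // drop0.
  have zE : z = slice 0 (size z) by rewrite /slice subn0 drop0 take_size.
  split=> [|[ps rps]].
    by rewrite {1}zE => /(subseq_reads 0)[ps rps _]; exists ps.
  rewrite zE; apply: (reads_subseq rps); apply/allP => p pin /=.
  have := map_f (fun p => (p.2, onth z p.1)) pin.
  by rewrite (proj2 rps) -map_comp => /mapP[a _ [_ zp]]; rewrite -onthTE zp.
split=> [|[js [ks [sj sk jl kj [[ps rps] noraise]]]]].
  rewrite -{1}[z]drop0 => /(threshold_factors_cuts l_gt0)[js0].
  move=> /(heavy_cuts_max vsP)[js hjs noraise].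
  have [sj jl] := heavy_cuts_weights hjs.
  have [ks [sk kj] [ps rps _]] := probe_complete 0 vsP hjs.
  exists js, ks; split=> //; split; first by exists ps.
  by move=> i ivs il /(powP _ _ sj ivs); apply: noraise.
rewrite -[z]drop0; have [|_ [|[i [ivs il]]]] := probe_sound (c := 0) vsP jl sj sk rps.
- by [].
- exact: cuts_threshold_factors.
by move/(powP _ _ sj ivs)/(noraise _ ivs il).
Qed.

End ProbeSequences.

(** * Bounds on the length and the delays of probes *)

Section ProbeBounds.
Variables (T : finType) (l : nat).
Implicit Types (vs : seq (seq T)) (js ks : seq nat).

Lemma size_pow_word vs js : all (leq^~ l) js ->
  size (pow_word vs js) <= l * size (flatten vs).
Proof.
elim: vs js => [|v vs IHvs] [|j js] //= /andP[jl jsl].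
by rewrite !size_cat mulnDr size_word_pow leq_add ?leq_mul2r ?jl ?orbT ?IHvs.
Qed.

Lemma size_factor_probe (v : seq T) a b d : a <= l -> b <= l ->
  size (factor_probe v a b d) <= (2 * l + 3) * size v.
Proof.
move=> al bl; rewrite /factor_probe !size_cat size_zip !size_map !size_cat.
rewrite !size_word_pow size_take size_behead size_iota size_rev minnn.
have := leq_mul al (leqnn (size v)); have := leq_mul bl (leqnn (size v)).
by case: ifP; nia.
Qed.

Lemma size_probe vs js ks d : all (leq^~ l) js -> all2 leq ks js ->
  size (probe l vs js ks d) <= (2 * l + 3) * size (flatten vs).
Proof.
elim: vs js ks d => [|v vs IHvs] [|j js] [|k ks] //= d /andP[jl jsl] /andP[kj ksj].
rewrite size_cat mulnDr; case: ifP => _; rewrite size_cat leq_add ?IHvs //.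
  by rewrite size_map size_word_pow leq_mul2r; lia.
by apply: size_factor_probe; lia.
Qed.

Lemma probe_delay vs js ks d : all factor_word vs ->
  all (fun t => t.1 <= d + size (flatten vs)) (probe l vs js ks d).
Proof.
elim: vs js ks d => [|v vs IHvs] [|j js] [|k ks] //= d /andP[/andP[v0 _] vsP].
have v1 : 0 < size v by case: v v0.
have IH d' : d' <= d + size v ->
    all (fun t => t.1 <= d + size (v ++ flatten vs)) (probe l vs js ks d').
  move=> dd'; apply: sub_all (IHvs js ks d' vsP) => t /= td; rewrite size_cat.
  by rewrite addnA (leq_trans td) // leq_add2r.
case: ifP => _; rewrite all_cat IH ?andbT; try lia.
  by rewrite all_map; apply/allP => x _ /=; rewrite leq_addr.
rewrite /factor_probe !all_cat; apply/and3P; split.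
- by rewrite all_map; apply/allP => x _ /=; rewrite leq_addr.
- apply/allP => t /(map_f fst); rewrite -/(unzip1 _) unzip1_zip ?size_iota ?size_rev //.
  rewrite mem_iota size_cat => /andP[_ /ltnW td]; apply: (leq_trans td).
  by rewrite leq_add2l leq_addr.
- by rewrite all_map; apply/allP => x _ /=; rewrite size_cat; lia.
Qed.

End ProbeBounds.

(** * Sorted sublists; threshold languages under letter maps, concatenation and splitting into
    letters *)

Lemma sorted_subset_subseq (T : eqType) (r : rel T) (s t : seq T) :
  transitive r -> irreflexive r -> sorted r s -> sorted r t ->
  {subset s <= t} -> subseq s t.
Proof.
move=> rtr rirr ss st sub.
rewrite (_ : s = filter (mem s) t) ?filter_subseq //.
apply: (irr_sorted_eq rtr rirr) => //; first exact: sorted_filter.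
by move=> x; rewrite mem_filter andb_idr //; apply: sub.
Qed.

Lemma map_word_pow (A B : finType) (f : A -> B) v l :
  map f (word_pow v l) = word_pow (map f v) l.
Proof. by rewrite /word_pow map_flatten map_nseq. Qed.

Lemma threshold_factor_map (A B : finType) (f : A -> B) l v x :
  threshold_factor l v x -> threshold_factor l (map f v) (map f x).
Proof.
move/threshold_factorP => vx; apply/threshold_factorP.
case: vx => [/infixP[p [q ->]]|vx]; [left|right].
  by rewrite !map_cat infix_infix.
by rewrite -map_word_pow map_subseq.
Qed.

Lemma threshold_factors_cat (A : finType) l (us1 us2 : seq (seq A)) x1 x2 :
  threshold_factors l us1 x1 -> threshold_factors l us2 x2 ->
  threshold_factors l (us1 ++ us2) (x1 ++ x2).
Proof.
elim: us1 x1 => [|u us1 IH] x1 /=; first by move=> ->.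
move=> [y1 [y2 [uy1 us1y2 ->]]] us2x2; exists y1, (y2 ++ x2).
by rewrite catA; split=> //; apply: IH.
Qed.

Lemma threshold_factors_catP (A : finType) l (us1 us2 : seq (seq A)) x :
  threshold_factors l (us1 ++ us2) x -> exists x1 x2,
    [/\ threshold_factors l us1 x1, threshold_factors l us2 x2 & x = x1 ++ x2].
Proof.
elim: us1 x => [|u us1 IH] x /=; first by exists [::], x.
move=> [y [x' [uy /IH[x1 [x2 [h1 h2 ->]]] ->]]].
by exists (y ++ x1), x2; rewrite catA; split=> //; exists y, x1.
Qed.

(** As [l] is positive, containing $a^l$ implies containing [a]: for a one-letter word only the
    factor clause matters. *)
Lemma threshold_factors_letters (A : finType) l (s x : seq A) :
  0 < l -> s != [::] ->
  threshold_factors l [seq [:: a] | a <- s] x <-> subseq s x.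
Proof.
move=> l0; have letterP a y : threshold_factor l [:: a] y <-> a \in y.
  rewrite threshold_factorP infix1s; split=> [[//|]|]; last by left.
  by case: (l) l0 => // k _ /mem_subseq; apply; rewrite mem_head.
elim: s x => // a s IHs x _; split=> /=.
  move=> [y [y' [/letterP ay sy' ->]]].
  rewrite -cat1s cat_subseq ?sub1seq //.
  by case: s IHs sy' => [|b s] IHs; [rewrite sub0seq | move/IHs; apply].
case: s IHs => [|b s] IHs.
  by rewrite sub1seq => ax; exists x, [::]; rewrite cats0; split=> //; apply/letterP.
rewrite -cat1s => /cat_subseq_split[k ak sk]; exists (take k x), (drop k x).
rewrite cat_take_drop; split=> //; first by apply/letterP; rewrite -sub1seq.
exact/IHs.
Qed.

(** * Colouring letters by their positions *)

Section Colouring.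
Variables (Sigma : finType) (M : nat).
Local Notation Gamma := ('I_M.+1 * Sigma)%type.
Implicit Types (u w : seq Sigma) (x : seq Gamma) (vs : seq (seq Gamma)) (c l : nat).

(** The offset [c] allows a concatenation to be coloured piece by piece. *)
Definition coloured c w : seq Gamma :=
  [seq (inord (p.1 %% M.+1), p.2) | p <- zip (iota c (size w)) w].

Lemma coloured_cat c w1 w2 :
  coloured c (w1 ++ w2) = coloured c w1 ++ coloured (c + size w1) w2.
Proof.
by rewrite /coloured size_cat iotaD zip_cat ?size_iota // map_cat.
Qed.

Lemma map_snd_coloured c w : map snd (coloured c w) = w.
Proof.
rewrite /coloured -map_comp (@eq_map _ _ _ snd) // -/(unzip2 _).
by rewrite unzip2_zip ?size_iota.
Qed.

Lemma onth_coloured w i :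
  onth (coloured 0 w) i = omap (fun a => (inord (i %% M.+1), a)) (onth w i).
Proof.
rewrite /coloured onth_map; have [iw|wi] := ltnP i (size w); last first.
  by rewrite !onth_default // size_zip size_iota minnn.
case wi: (onth w i) => [a|]; last by move: iw; rewrite -onthTE wi.
rewrite onthE (nth_map (0, a)) ?size_zip ?size_iota ?minnn //.
by rewrite nth_zip ?size_iota // nth_iota //= (@onth_nth _ a _ _ _ wi).
Qed.

Lemma coloured_uniq c w : size w <= M.+1 -> uniq (coloured c w).
Proof.
move=> wM; apply: (@map_uniq _ _ fst).
rewrite /coloured -map_comp.
rewrite (_ : map _ _ = [seq inord (i %% M.+1) | i <- iota c (size w)]).
  have inj i j : c <= i -> j < c + size w -> i <= j ->
      i = j %[mod M.+1] -> i = j.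
    move=> ci jc ij /esym/eqP; rewrite eqn_mod_dvd // => /dvdnP[[|k] jik]; first lia.
    by move: jik; rewrite mulSn; lia.
  rewrite map_inj_in_uniq ?iota_uniq // => i j; rewrite !mem_iota.
  move=> /andP[ci ic] /andP[cj jc] /(congr1 val).
  rewrite /= !inordK ?ltn_pmod // => ij.
  have [le_ij|/ltnW le_ji] := leqP i j; first exact: inj.
  by apply/esym/inj.
by rewrite -[iota _ _ in RHS](@unzip1_zip _ _ _ w) ?size_iota // /unzip1 -map_comp.
Qed.

(* Colouring letters by position makes the letters of a factor distinct.  A
   subword u^l is instead coloured letter by letter, as a product of
   one-letter words. *)
Lemma coloured_threshold_factor l u w c : 0 < l -> u != [::] -> size u <= M.+1 ->
  threshold_factor l u w -> exists vs, [/\ vs != [::], all factor_word vs,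
    size (flatten vs) <= l * size u, threshold_factors l vs (coloured c w) &
    forall x, threshold_factors l vs x -> threshold_factor l u (map snd x)].
Proof.
move=> l0 u0 uM /threshold_factorP[/infixP[p [q ->]]|ulw].
  pose v := coloured (c + size p) u.
  have vu : map snd v = u by rewrite map_snd_coloured.
  have sv : size v = size u by rewrite -[in RHS]vu size_map.
  exists [:: v]; split=> //.
  - by rewrite /= /factor_word coloured_uniq // !andbT -size_eq0 sv size_eq0.
  - by rewrite /= cats0 sv leq_pmull.
  - rewrite !coloured_cat; eexists; exists [::]; rewrite cats0; split=> //.
    by apply/threshold_factorP; left; apply: infix_infix.
  - move=> _ [y [_ [vy -> ->]]]; rewrite cats0 -vu.
    exact: threshold_factor_map.
move: ulw; rewrite -{1}(map_snd_coloured c w) => /subseqP[m sm].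
rewrite -map_mask; set s := mask _ _ => us.
have ss : size s = l * size u by rewrite -size_word_pow us size_map.
have s0 : s != [::] by rewrite -size_eq0 ss muln_eq0 size_eq0 negb_or u0 -lt0n l0.
exists [seq [:: a] | a <- s]; split.
- by case: (s) s0.
- by rewrite all_map; apply/allP.
- by rewrite -ss flatten_map1 size_map.
- by apply/threshold_factors_letters => //; apply: mask_subseq.
- move=> x /threshold_factors_letters sx; apply/threshold_factorP; right.
  by rewrite us map_subseq ?sx.
Qed.

(** The words [vs] depend on [w], but the bound on their total length does not. The last clause
    covers every [x], in particular colourings of other inputs. *)
Lemma coloured_threshold_factors l us w c : 0 < l ->
  all (fun u => (u != [::]) && (size u <= M.+1)) us ->
  threshold_factors l us w -> exists vs, [/\ size us <= size vs,
    all factor_word vs, size (flatten vs) <= l * size (flatten us),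
    threshold_factors l vs (coloured c w) &
    forall x, threshold_factors l vs x -> threshold_factors l us (map snd x)].
Proof.
move=> l0; elim: us w c => [|u us IHus] w c.
  by move=> _ ->; exists [::]; split=> // x ->.
move=> /andP[/andP[u0 uM] usP] [x [y [ux usy ->]]].
have [vs [vs0 vsP szvs vsx backx]] := coloured_threshold_factor c l0 u0 uM ux.
have [vs' [s's vs'P szvs' vs'y backy]] := IHus y (c + size x) usP usy.
exists (vs ++ vs'); rewrite coloured_cat; split.
- by rewrite size_cat; case: (vs) vs0 => //= *; lia.
- by rewrite all_cat vsP.
- by rewrite flatten_cat !size_cat mulnDr leq_add.
- exact: threshold_factors_cat.
move=> _ /threshold_factors_catP[x1 [x2 [/backx h1 /backy h2 ->]]].
by rewrite map_cat; exists (map snd x1), (map snd x2).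
Qed.

End Colouring.

(** * Assembling the program *)

Section DelayedProgram.
Variables (Sigma : finType) (M D : nat).
Local Notation Gamma := ('I_M.+1 * Sigma)%type.
Local Notation Tag := ('I_D.+1 * 'I_M.+1)%type.
Implicit Types (n : nat).

Definition reading n (p : 'I_n * 'I_D.+1) : nat * nat := (val p.1, val p.2).

(** Sorting uses a total non-strict relation, here the negated converse of [read_lt]. *)
Definition schedule n : seq ('I_n * 'I_D.+1) :=
  sort (fun p q => ~~ read_lt (reading q) (reading p)) (enum predT).

Lemma reading_inj n : injective (@reading n).
Proof. by move=> [i d] [i' d'] [/val_inj-> /val_inj->]. Qed.

Lemma mem_schedule n p : p \in schedule n.
Proof. by rewrite mem_sort mem_enum. Qed.

Lemma schedule_sorted n : sorted (relpre (@reading n) read_lt) (schedule n).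
Proof.
pose le (p q : 'I_n * 'I_D.+1) := ~~ read_lt (reading q) (reading p).
have total_le : total le.
  by move=> p q; rewrite /le /read_lt; lia.
have trans_le : transitive le.
  by move=> p q r; rewrite /le /read_lt; lia.
have := sort_sorted total_le (enum predT); rewrite -/(schedule n).
rewrite (sorted_pairwise trans_le) => le_s.
have : uniq (schedule n) by rewrite sort_uniq enum_uniq.
rewrite uniq_pairwise => ne_s.
have trans_lt : transitive (relpre (@reading n) read_lt).
  by move=> p q r; apply: read_lt_trans.
rewrite (sorted_pairwise trans_lt).
have : pairwise [rel p q | le p q && (p != q)] (schedule n).
  by rewrite pairwise_relI le_s ne_s.
apply: sub_pairwise => p q /= /andP[nlt ne].
have {ne} : reading p != reading q by rewrite (inj_eq (@reading_inj n)).
move: nlt; rewrite /le; case: (reading p) (reading q) => [i d] [i' d'].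
by rewrite /read_lt /= xpair_eqE; lia.
Qed.

(** The colour depends only on the position, so it can be part of the tag. *)
Definition delayed_program n : seq ('I_n * Tag) :=
  [seq (p.1, (p.2, inord (val p.1 %% M.+1))) | p <- schedule n].

Lemma size_delayed_program n : size (delayed_program n) = D.+1 * n.
Proof.
by rewrite size_map size_sort -cardE card_prod !card_ord mulnC.
Qed.

Definition retag (t : 'I_D.+1 * Gamma) : Tag * Sigma := ((t.1, t.2.1), t.2.2).

(** The output lists every reading once in the order [read_lt], so its subwords are exactly the
    words that can be read. *)
Lemma delayed_program_reads n (w : n.-tuple Sigma) (tau : seq ('I_D.+1 * Gamma)) :
  subseq (map retag tau) (program_output (delayed_program n) w) <->
  exists ps, reads (coloured M 0 w) ps [seq (val t.1, t.2) | t <- tau].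
Proof.
pose letter (p : 'I_n * 'I_D.+1) : 'I_D.+1 * Gamma :=
  (p.2, (inord (p.1 %% M.+1), tnth w p.1)).
have onthw (i : 'I_n) : onth (coloured M 0 w) i = Some (inord (i %% M.+1), tnth w i).
  rewrite onth_coloured; have : onth w i by rewrite onthTE size_tuple.
  by case wi: (onth w i) => [a|] // _; rewrite (tnth_nth a) (@onth_nth _ a _ _ _ wi).
have outE : program_output (delayed_program n) w = map retag (map letter (schedule n)).
  by rewrite /program_output -!map_comp.
have retag_inj : injective retag.
  by move=> [d [k a]] [d' [k' a']] [-> -> ->].
have readsE qs :
    [seq (p.2, onth (coloured M 0 w) p.1) | p <- map (@reading n) qs] =
    [seq (t.1, Some t.2) | t <- [seq (val t.1, t.2) | t <- map letter qs]].
  by rewrite -!map_comp; apply: eq_map => p /=; rewrite onthw.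
rewrite outE; split=> [/subseqP[m _]|[ps [psS psE]]].
  rewrite -!map_mask => /(inj_map retag_inj) ->.
  exists (map (@reading n) (mask m (schedule n))).
  split; last exact: readsE.
  rewrite sorted_map; apply: (subseq_sorted _ (mask_subseq _ _) (schedule_sorted n)).
  by move=> p q r; apply: read_lt_trans.
(* Reading a letter forces the position to be below [n], so every pair in [ps] comes from an
   instruction. *)
have [qs [defps deftau]] : exists qs, ps = map (@reading n) qs /\ tau = map letter qs.
  elim: ps tau psE {psS} => [|[i d] ps IH] [|[d' g] tau] //=; first by exists [::].
  case=> -> ig /IH[qs [-> ->]].
  have iw : i < n.
    rewrite ltnNge; apply/negP => ni; move: ig.
    by rewrite onth_coloured onth_default ?size_tuple.
  exists ((Ordinal iw, d') :: qs); split=> //=; congr (_ :: _); congr (_, _).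
  by have := onthw (Ordinal iw); rewrite /= ig => -[].
rewrite deftau; do 2![apply: map_subseq].
apply: (@sorted_subset_subseq _ (relpre (@reading n) read_lt)).
- by move=> p q r; apply: read_lt_trans.
- by move=> p; apply: read_lt_irr.
- by rewrite -sorted_map -defps.
- exact: schedule_sorted.
- by move=> p _; apply: mem_schedule.
Qed.

End DelayedProgram.

(** All probes and raised powers have bounded length and delays, so inputs with the same short
    subwords admit the same ones. The characterization by probes passes from the coloured [w] to the
    coloured [w'], and colours are then erased. *)
Lemma threshold_factors_subword_determined
    (Sigma : finType) l (us : seq (seq Sigma)) :
  0 < l -> 0 < size us -> all (fun u => u != [::]) us ->
  subword_determined (threshold_factors l us).
Proof.
(* [M.+1] colours separate the letters of each word of [us]; [W] bounds the total length of the
   coloured words, hence the delays. *)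
move=> l0 us0 usP; pose M := size (flatten us); pose W := l * M.
exists ('I_W.+1 * 'I_M.+1)%type, ((2 * l + 3) * W), W.+1, (delayed_program M W).
split=> [n|n w w' ww']; first by rewrite size_delayed_program.
have usM : all (fun u => (u != [::]) && (size u <= M.+1)) us.
  apply/allP => u uin; rewrite (allP usP) //= ltnW // ltnS.
  rewrite /M; elim: (us) uin => //= u' us' IH.
  by rewrite inE size_cat => /predU1P[->|/IH]; lia.
have same_reads tau :
    size tau <= (2 * l + 3) * W -> all (fun t => t.1 <= W) tau ->
    (exists ps, reads (coloured M 0 w) ps tau) <->
    (exists ps, reads (coloured M 0 w') ps tau).
  move=> szt /allP tW; pose tau' := [seq (inord t.1 : 'I_W.+1, t.2) | t <- tau].
  have -> : tau = [seq (val t.1, t.2) | t <- tau'].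
    rewrite -map_comp -[LHS]map_id; apply/eq_in_map => -[d g] /tW /= dW.
    by rewrite inordK.
  by rewrite -!delayed_program_reads ww' // !size_map.
move=> /(coloured_threshold_factors 0 l0 usM)[vs [szvs vsP bvs vsw back]].
rewrite -/M -/W in bvs.
have vs0 : vs != [::] by rewrite -size_eq0 -lt0n (leq_trans us0).
rewrite -(map_snd_coloured M 0 w'); apply: back.
move: vsw => /(threshold_factors_probe _ l0 vs0 vsP)[js [ks [sj sk jl kj [rw nw]]]].
apply/(threshold_factors_probe _ l0 vs0 vsP); exists js, ks; split=> //; split.
  apply/same_reads => //.
    by rewrite (leq_trans (size_probe _ _ jl kj)) // leq_mul2l bvs orbT.
  apply: sub_all (probe_delay l js ks 0 vsP) => t /=; rewrite add0n => tle.
  exact: leq_trans tle bvs.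
move=> i ivs il /same_reads rw'; apply: (nw i ivs il); apply: rw'.
  have jl' : all (leq^~ l) (incr_nth js i) by rewrite all_leq_incr_nth ?sj.
  by rewrite size_map (leq_trans (size_pow_word vs jl')) // leq_mul //; lia.
by rewrite all_map; apply/allP.
Qed.

Theorem theorem4p6 (R : realType) (Sigma : finType) (L : language Sigma)
    (hL : threshold_dot_depth_one L) :
  in_PJ R L.
Proof.
apply: subword_determined_in_PJ.
apply: boolean_combination_subword_determined hL => K [u _|u _|l us l0 us0 usP].
- exact: suffix_subword_determined.
- exact: prefix_subword_determined.
- exact: threshold_factors_subword_determined.
Qed.
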